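(* Let $r_0>0$, $k\geq 2$, $m>0$ with $m\neq1$, and let $\overline{M}=\overline{B_{r_0}(0)}$ be a closed geodesic ball of radius $r_0$ in the hyperbolic plane $(\mathbb{H}^2,g_{-1})$, $g_{-1}=dr^2+\sinh^2(r)\,d\theta^2$ in geodesic polar coordinates, with interior $M$ and boundary $\partial M$. Let $\xi(t)=1+e^{-2t}(m-1)$ and $k_{\bar g(t)}\big|_{\partial M}=\xi(t)^{-1/2}\frac{\cosh(r_0)}{\sinh(r_0)}$. Let $\rho\in C^k([0,\infty))$ satisfy $\rho(0)=\rho^{(j)}(0)=0$ for $1\leq j\leq k$, $\rho'(t)\geq0$ for $t\geq0$, and $\rho'(t)>0$ for $t\in(0,t_1)$ for some $t_1>0$, and set $\eta(t)=k_{\bar g(t)}|_{\partial M}+\rho(t)$. If $m>1$, assume $\rho'(t)\geq (1-\xi(t)^{-1})\rho(t)$ for all $t\geq0$. Suppose further that $\eta\leq y(t)^{1/3}-2$ on $\partial M\times[0,\infty)$, where $y\in C^3([0,\infty))$ is a positive function with $y'\geq 3y+1$ on $[0,\infty)$. Assume that when $m\in(0,1)$ there exist constants $T>0$ and small $\epsilon>0$ with $\rho'(t)\geq \epsilon(1+t)^{-1}(\ln(1+t))^{-1}$ for $t\geq T$, while when $m>1$ there exist constants $T>0$ and small $\epsilon>0$ with $\rho'(t)-(1-\xi(t)^{-1})\rho(t)\geq \epsilon(1+t)^{-1}(\ln(1+t))^{-1}$ for $t\geq T$. Then the solution $g(t)$ of $$\partial_t g=-2(K_g+1)g\ \text{in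 }\overline M\times[0,\infty),\qquad k_g=\eta\ \text{on }\partial M\times[0,\infty),\qquad g|_{t=0}=m\,g_{-1}\ \text{in }\overline M$$ converges locally uniformly in $M$ to a complete hyperbolic metric as $t\to\infty$.
   Context: $K_g$ is the Gaussian curvature of $g$ and $k_g$ is the geodesic curvature of $\partial M$ with respect to $g$. This is the two-dimensional normalized Ricci flow $\partial_t g=-2(\mathrm{Ric}_g+g)$ with prescribed boundary geodesic curvature. *)

(* Defs.v *)
From Stdlib Require Import Reals Lra.
From Coquelicot Require Import Coquelicot.
Open Scope R_scope.

(* ---------- The model: hyperbolic plane as Poincare disk ----------------
   (H^2, g_{-1}) is realised as the unit disk with
   g_{-1} = e^{2 phi} |dx|^2,  phi(x) = ln (2 / (1 - |x|^2)).
   The closed geodesic ball B_{r0}(0) is the closed Euclidean disk of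
   radius tanh(r0/2).  Every metric in the conformal class is written
   e^{2W} |dx|^2 with W a (Euclidean) conformal factor. *)

Definition pt := (R * R)%type.

Definition nrm2 (p : pt) : R := fst p ^ 2 + snd p ^ 2.

Definition ball_radius (r0 : R) : R := tanh (r0 / 2).

Definition closed_disk (Rd : R) (p : pt) : Prop := nrm2 p <= Rd ^ 2.
Definition open_disk (Rd : R) (p : pt) : Prop := nrm2 p < Rd ^ 2.
Definition on_circle (Rd : R) (p : pt) : Prop := nrm2 p = Rd ^ 2.

Definition hyp_factor (p : pt) : R := ln (2 / (1 - nrm2 p)).

Definition d1 (f : pt -> R) (p : pt) : R := Derive (fun a => f (a, snd p)) (fst p).
Definition d2 (f : pt -> R) (p : pt) : R := Derive (fun b => f (fst p, b)) (snd p).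

Definition lap (f : pt -> R) (p : pt) : R := d1 (d1 f) p + d2 (d2 f) p.

Definition C2_on (U : pt -> Prop) (f : pt -> R) : Prop :=
  forall q, U q ->
    (forall g, (g = f \/ g = d1 f \/ g = d2 f) ->
       ex_derive (fun a => g (a, snd q)) (fst q) /\
       ex_derive (fun b => g (fst q, b)) (snd q)) /\
    (forall g, (g = f \/ g = d1 f \/ g = d2 f \/ g = d1 (d1 f) \/
                g = d1 (d2 f) \/ g = d2 (d1 f) \/ g = d2 (d2 f)) ->
       continuous g q).

Definition gauss_curv (W : pt -> R) (p : pt) : R := - exp (-2 * W p) * lap W p.

Definition outward_deriv (f : pt -> R) (p : pt) (d : R) : Prop :=
  filterlim (fun s => (f p - f (s * fst p, s * snd p)) / ((1 - s) * sqrt (nrm2 p)))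
            (at_left 1) (locally d).

(* geodesic curvature of the circle |x| = Rd w.r.t. e^{2W}|dx|^2, given the
   outward radial derivative dn of W at p *)
Definition geod_curv_circle (Rd : R) (W : pt -> R) (p : pt) (dn : R) : R :=
  exp (- W p) * (/ Rd + dn).

(* W t p is the conformal factor of g(t) = e^{2 W t} |dx|^2 *)
Definition dt (W : R -> pt -> R) (t : R) (p : pt) : R := Derive (fun s => W s p) t.

(* Classical solution of
     d_t g = -2 (K_g + 1) g   in  closed ball x [0,oo),
     k_g = eta                on  boundary x [0,oo)  (for t > 0),
     g(0) = m g_{-1}.
   Since g = e^{2W}|dx|^2 the equation reads d_t W = -(K_g + 1). *)
Definition classical_solution (r0 m : R) (eta : R -> R) (W : R -> pt -> R) : Prop :=
  let Rd := ball_radius r0 in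
  (forall t p, 0 <= t -> closed_disk Rd p ->
     filterlim (fun q : R * pt => W (fst q) (snd q))
       (within (fun q : R * pt => 0 <= fst q /\ closed_disk Rd (snd q))
               (locally (t, p)))
       (locally (W t p))) /\
  (forall t, 0 < t -> C2_on (open_disk Rd) (W t)) /\
  (forall t p, 0 < t -> open_disk Rd p ->
     ex_derive (fun s => W s p) t /\
     continuous (fun q : R * pt => dt W (fst q) (snd q)) (t, p) /\
     dt W t p = - (gauss_curv (W t) p + 1)) /\
  (forall t p, 0 < t -> on_circle Rd p ->
     exists dn, outward_deriv (W t) p dn /\ geod_curv_circle Rd (W t) p dn = eta t) /\
  (forall p, closed_disk Rd p -> W 0 p = ln m / 2 + hyp_factor p).

Definition adm_curve (Rd : R) (g1 g2 : R -> R) (p q : pt) : Prop :=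
  (forall s, 0 <= s <= 1 ->
     ex_derive g1 s /\ ex_derive g2 s /\
     continuous (Derive g1) s /\ continuous (Derive g2) s /\
     open_disk Rd (g1 s, g2 s)) /\
  (g1 0, g2 0) = p /\ (g1 1, g2 1) = q.

Definition curve_length (W : pt -> R) (g1 g2 : R -> R) : R :=
  RInt (fun s => exp (W (g1 s, g2 s)) *
                 sqrt (Derive g1 s ^ 2 + Derive g2 s ^ 2)) 0 1.

Definition riem_dist (Rd : R) (W : pt -> R) (p q : pt) : Rbar :=
  Glb_Rbar (fun L => exists g1 g2, adm_curve Rd g1 g2 p q /\ L = curve_length W g1 g2).

Definition complete_metric (Rd : R) (W : pt -> R) : Prop :=
  forall x : nat -> pt, (forall n, open_disk Rd (x n)) ->
    (forall eps, 0 < eps -> exists N, forall n k, (N <= n)%nat -> (N <= k)%nat ->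
        Rbar_lt (riem_dist Rd W (x n) (x k)) (Finite eps)) ->
    exists p, open_disk Rd p /\
      forall eps, 0 < eps -> exists N, forall n, (N <= n)%nat ->
        Rbar_lt (riem_dist Rd W (x n) p) (Finite eps).

Definition complete_hyperbolic (Rd : R) (W : pt -> R) : Prop :=
  C2_on (open_disk Rd) W /\
  (forall p, open_disk Rd p -> gauss_curv W p = -1) /\
  complete_metric Rd W.

(* locally uniform convergence in the open disk of the metrics
   e^{2W t}|dx|^2 to e^{2 Winf}|dx|^2 (compacts of the open disk are
   exhausted by the closed disks of radius r < Rd) *)
Definition loc_unif_conv (Rd : R) (W : R -> pt -> R) (Winf : pt -> R) : Prop :=
  forall r, 0 < r < Rd -> forall eps, 0 < eps -> exists T, forall t, T <= t ->
    forall p, closed_disk r p -> Rabs (exp (2 * W t p) - exp (2 * Winf p)) < eps.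

(* ---------- C^k functions on [0,oo) ----------
   represented by functions on R that are C^k on some (-delta, oo) *)
Definition Ck_nonneg (k : nat) (f : R -> R) : Prop :=
  exists delta, 0 < delta /\ forall t, - delta < t -> forall j, (j <= k)%nat ->
    ex_derive_n f j t /\ continuous (Derive_n f j) t.

Definition xi (m t : R) : R := 1 + exp (-2 * t) * (m - 1).
Definition kbar (r0 m t : R) : R := / sqrt (xi m t) * (cosh r0 / sinh r0).

(* Main.v *)
From Pilot Require Import Defs.
From Stdlib Require Import Reals.
From Coquelicot Require Import Coquelicot.
From Stdlib Require Import Lra Lia Classical ClassicalEpsilon.
(* Stdlib's Ranalysis also has a [d1]; this makes [d1] the partial derivative again. *)
Import Pilot.Defs.
Open Scope R_scope.

(** Write [g(t) = e^{2W}|dx|^2] and [Q = Rd^2], and let the limit be [2Rd / (Q - |x|^2)], the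
    complete hyperbolic factor of the disk. Above, [W] is compared with the factor of
    [(1 + eps + m e^{-2t})] times the complete metric: it is infinite on the circle, so the
    boundary condition plays no role. Below, [W] is compared with the factor of a multiple
    [th * xi(t)] of the hyperbolic metric of a larger concentric disk, of squared radius [q(t)].
    With [th = 1], [q = 1] this is the solution for [rho = 0] and gives a first bound up to a time
    [T0] with [rho(T0) > 0]. From then on the slack [rho(t) >= rho(T0)] in the boundary condition
    allows [th] slightly below 1, and the slack [1/th - 1] this leaves in the flow inequality allows
    [q] to shrink exponentially to [Q]. Letting [t -> oo] and then [th -> 1] squeezes [W]. *)

(** * Compactness and derivative tests at an extremum *)

(** A hyperbolic metric times a constant [s] has curvature [- / s]. Hence the factor [th] raises the
    right side of the flow from [/ xi - 1] to [/ (th * xi) - 1], a gain, but it multiplies geodesic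
    curvatures by [/ sqrt th], a cost that [rho] has to pay. Since [rho 0 = 0], nothing can be paid
    at time 0, which forces the two phases. Letting [q] decrease by [q' = - c (q - Q)] adds at most
    [c (q - Q) / (q - |x|^2) <= c] to the time derivative of the barrier, so the gain from [th]
    admits a small [c > 0]. The rate [q - Q] is what keeps this term bounded up to the circle. At
    the boundary the shrinking is free: in the hyperbolic metric of the disk of squared radius [q],
    the circle [|x|^2 = Q] has curvature [(q + Q) / (2 Rd sqrt q)], which for [Q <= sqrt q <= 1]
    does not exceed its value at [q = 1], namely [coth r0]. *)

Lemma compact_max (K : R * pt -> Prop) (A : R) (f : R * pt -> R) :
  (exists u, K u) ->
  (forall u, K u -> Rabs (fst u) <= A /\ Rabs (fst (snd u)) <= A /\ Rabs (snd (snd u)) <= A) ->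
  closed K ->
  continuous_on K f ->
  exists u, K u /\ forall v, K v -> f v <= f u.
Proof.
  intros [u0 K0] Kbd Kcl fc.
  (* Without a maximum, each point of [K] is beaten by another one, which by continuity beats a
     whole neighbourhood. Finitely many neighbourhoods cover [K]; the best of their winners lies in
     one of them and is thus beaten by a winner no better than itself. *)
  apply NNPP; intros Hno.
  assert (Hlt : forall u, K u -> exists v, K v /\ f u < f v).
  { intros u Ku. apply NNPP; intros H. apply Hno. exists u. split; [exact Ku|].
    intros v Kv. destruct (Rle_or_lt (f v) (f u)) as [|Hv]; [assumption|].
    exfalso; apply H; exists v; split; assumption. }
  assert (Hnb : forall u, exists dv : posreal * (R * pt),
    forall w, ball u (fst dv) w -> K w -> K (snd dv) /\ f w < f (snd dv)).
  { intros u. destruct (classic (K u)) as [Ku|nKu].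
    - destruct (Hlt u Ku) as [v [Kv Hv]].
      assert (Hd : 0 < f v - f u) by lra.
      destruct (fc u Ku (fun z => z < f v)) as [d Hd'].
      { exists (mkposreal _ Hd). intros z Hz.
        unfold ball in Hz; simpl in Hz; unfold AbsRing_ball, abs, minus, plus, opp in Hz; simpl in Hz.
        apply Rabs_def2 in Hz. lra. }
      exists (d, v). intros w Hw Kw. simpl in *. split; [exact Kv | exact (Hd' w Hw Kw)].
    (* The gauge must be defined on the whole box. Off [K], closedness gives a ball that misses [K],
       and [u0] is only a filler. *)
    - destruct (NNPP _ (fun Hn => nKu (Kcl u Hn))) as [d Hd]. exists (d, u0).
      intros w Hw Kw. exfalso. exact (Hd w Hw Kw). }
  set (g := fun u => proj1_sig (constructive_indefinite_description _ (Hnb u))).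
  assert (Hg : forall u w, ball u (fst (g u)) w -> K w -> K (snd (g u)) /\ f w < f (snd (g u)))
    by (intros u; exact (proj2_sig (constructive_indefinite_description _ (Hnb u)))).
  clearbody g.
  set (pos3 := fun x : Compactness.Tn 3 R =>
    (fst x, (fst (snd x), fst (snd (snd x)))) : R * pt).
  apply (compactness_list 3 (- A, (- A, (- A, tt))) (A, (A, (A, tt)))
    (fun x => fst (g (pos3 x)))).
  intros [l Hl].
  assert (Hmax : forall l : list (Compactness.Tn 3 R), exists v, K v /\
     forall x, List.In x l -> K (snd (g (pos3 x))) -> f (snd (g (pos3 x))) <= f v).
  { clear l Hl. induction l as [|x l [v [Kv IH]]].
    - exists u0. split; [exact K0|]. intros x [].
    - destruct (classic (K (snd (g (pos3 x))))) as [Kx|nKx].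
      + destruct (Rle_or_lt (f (snd (g (pos3 x)))) (f v)) as [H|H].
        * exists v. split; [exact Kv|]. intros z [<-|Hz] Kz; [exact H | exact (IH z Hz Kz)].
        * exists (snd (g (pos3 x))). split; [exact Kx|].
          intros z [<-|Hz] Kz; [lra|]. specialize (IH z Hz Kz). lra.
      + exists v. split; [exact Kv|]. intros z [<-|Hz] Kz; [contradiction|exact (IH z Hz Kz)]. }
  destruct (Hmax l) as [[t [x y]] [Kv Hv]].
  destruct (Kbd _ Kv) as [B1 [B2 B3]]; simpl in B1, B2, B3.
  apply Rabs_le_between in B1. apply Rabs_le_between in B2. apply Rabs_le_between in B3.
  destruct (Hl (t, (x, (y, tt)))) as [[t' [x' [y' []]]] [Hin [_ Hcl]]].
  { simpl. tauto. }
  simpl in Hcl. destruct Hcl as [C1 [C2 [C3 _]]].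
  destruct (Hg (t', (x', y')) (t, (x, y))) as [Kg Hfg].
  { split; [exact C1|]. split; [exact C2|exact C3]. }
  { exact Kv. }
  exact (Rlt_not_le _ _ Hfg (Hv _ Hin Kg)).
Qed.

(** The left difference quotients are nonpositive. The minimum is one-sided because a touching time
    may be the last time of the cylinder. *)
Lemma derive_nonpos_of_left_min (f : R -> R) (x l a : R) :
  a < x -> is_derive f x l -> (forall s, a <= s <= x -> f x <= f s) -> l <= 0.
Proof.
  intros Hax Hd Hmin. apply is_derive_Reals in Hd.
  destruct (Rle_or_lt l 0) as [|Hl]; [assumption|exfalso].
  destruct (Hd l Hl) as [d Hd'].
  set (h := Rmin (d / 2) (x - a)).
  assert (Hh : 0 < h <= x - a /\ h < d).
  { pose proof (cond_pos d). unfold h. split; [split|].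
    - apply Rmin_pos; lra.
    - apply Rmin_r.
    - apply Rle_lt_trans with (d / 2); [apply Rmin_l|lra]. }
  assert (H := Hd' (- h)). rewrite Rabs_Ropp, Rabs_pos_eq in H by lra.
  specialize (H ltac:(lra) ltac:(lra)).
  apply Rabs_def2 in H. destruct H as [_ H].
  assert (Hm := Hmin (x + - h) ltac:(lra)).
  assert ((f (x + - h) - f x) / - h <= 0).
  { replace ((f (x + - h) - f x) / - h) with (- ((f (x + - h) - f x) * / h)) by (field; lra).
    assert (0 <= (f (x + - h) - f x) * / h); [|lra].
    apply Rmult_le_pos; [lra|]. left; apply Rinv_0_lt_compat; lra. }
  lra.
Qed.

(** Half of Fermat's condition, [f' x <= 0], is enough: if [l < 0] then [f'] is negative just to the
    right of [x], and the mean value theorem pushes [f] below [f x] there. *)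
Lemma second_derive_test (f f' : R -> R) (x l : R) :
  locally x (fun s => is_derive f s (f' s)) -> is_derive f' x l ->
  locally x (fun s => f x <= f s) -> 0 <= l.
Proof.
  intros [d1 H1] H2 [d2 H3].
  set (d := Rmin d1 d2).
  assert (Hd : 0 < d) by (apply Rmin_pos; apply cond_pos).
  assert (B1 : forall s, Rabs (s - x) < d -> is_derive f s (f' s)).
  { intros s Hs. apply H1. apply Rlt_le_trans with d; [exact Hs|apply Rmin_l]. }
  assert (B2 : forall s, Rabs (s - x) < d -> f x <= f s).
  { intros s Hs. apply H3. apply Rlt_le_trans with d; [exact Hs|apply Rmin_r]. }
  assert (Z0 : f' x <= 0).
  { apply (derive_nonpos_of_left_min f x (f' x) (x - d / 2)); [lra| |].
    - apply B1. replace (x - x) with 0 by ring. rewrite Rabs_R0; exact Hd.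
    - intros s Hs. apply B2. apply Rabs_def1; lra. }
  destruct (Rle_or_lt 0 l) as [|Hl]; [assumption|exfalso].
  apply is_derive_Reals in H2.
  destruct (H2 (- l) ltac:(lra)) as [d3 Hd3].
  set (h := Rmin (d / 2) (d3 / 2)).
  assert (Hh : 0 < h /\ h < d /\ h < d3).
  { pose proof (cond_pos d3). unfold h. split; [apply Rmin_pos; lra|].
    split; [apply Rle_lt_trans with (d / 2); [apply Rmin_l|lra]
           |apply Rle_lt_trans with (d3 / 2); [apply Rmin_r|lra]]. }
  destruct (MVT_cor2 f f' x (x + h)) as [c [Hc1 Hc2]]; [lra| |].
  { intros c Hc. apply is_derive_Reals, B1. apply Rabs_def1; lra. }
  assert (Hb := B2 (x + h) ltac:(apply Rabs_def1; lra)).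
  assert (Hfc : 0 <= f' c).
  { destruct (Rle_or_lt 0 (f' c)) as [|Hn]; [assumption|]. nra. }
  assert (H := Hd3 (c - x) ltac:(lra) ltac:(apply Rabs_def1; lra)).
  replace (x + (c - x)) with c in H by ring.
  apply Rabs_def2 in H. destruct H as [H _].
  assert (0 <= (f' c - f' x) / (c - x)).
  { apply Rmult_le_pos; [lra|]. left; apply Rinv_0_lt_compat; lra. }
  lra.
Qed.

(** This is the quotient of [outward_deriv] along a radius parametrised to reach the circle at 1. *)
Lemma left_quotient_lim (f : R -> R) (l : R) :
  is_derive f 1 l -> filterlim (fun s => (f 1 - f s) / (1 - s)) (at_left 1) (locally l).
Proof.
  intros Hd. apply is_derive_Reals in Hd. apply filterlim_locally. intros eps.
  destruct (Hd eps (cond_pos eps)) as [d Hd'].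
  assert (H : forall s : R, Rabs (s - 1) < d -> s < 1 ->
    Rabs ((f 1 - f s) / (1 - s) - l) < eps).
  { intros s Hs Hlt. specialize (Hd' (s - 1) ltac:(lra) Hs).
    replace (1 + (s - 1)) with s in Hd' by ring.
    replace ((f 1 - f s) / (1 - s)) with ((f s - f 1) / (s - 1)) by (field; lra).
    exact Hd'. }
  exists d. exact H.
Qed.

Lemma second_derive_compare (f f' g g' : R -> R) (x lf lg : R) :
  locally x (fun s => is_derive f s (f' s)) -> is_derive f' x lf ->
  locally x (fun s => is_derive g s (g' s)) -> is_derive g' x lg ->
  locally x (fun s => g s <= f s) -> g x = f x -> lg <= lf.
Proof.
  intros Hf Hlf Hg Hlg Hle Heq.
  enough (0 <= lf - lg) by lra.
  apply (second_derive_test (fun s => f s - g s) (fun s => f' s - g' s) x).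
  - generalize (filter_and _ _ Hf Hg). apply filter_imp. intros s [H1 H2].
    exact (is_derive_minus f g s _ _ H1 H2).
  - exact (is_derive_minus f' g' x _ _ Hlf Hlg).
  - revert Hle. apply filter_imp. intros s Hs. lra.
Qed.

Lemma locally_lt {U : UniformSpace} (f : U -> R) (c : R) (x : U) :
  continuous f x -> f x < c -> locally x (fun s => f s < c).
Proof. intros Hf Hx. exact (Hf (fun z => z < c) (open_lt c (f x) Hx)). Qed.

Lemma nrm2_nonneg (p : pt) : 0 <= nrm2 p.
Proof. unfold nrm2. nra. Qed.

Lemma continuous_nrm2 (p : pt) : continuous nrm2 p.
Proof.
  apply (continuous_plus (V := R_NormedModule) (fun p : pt => fst p ^ 2) (fun p : pt => snd p ^ 2)).
  - apply (continuous_comp fst (fun a => a ^ 2)); [apply continuous_fst|].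
    apply (ex_derive_continuous (fun a => a ^ 2)). now auto_derive.
  - apply (continuous_comp snd (fun a => a ^ 2)); [apply continuous_snd|].
    apply (ex_derive_continuous (fun a => a ^ 2)). now auto_derive.
Qed.

Lemma slice_barrier_derive (A k e c mu s : R) :
  s ^ 2 < k ->
  is_derive (fun s => A - ln (k - s ^ 2) - e * exp (c + mu * s ^ 2)) s
    (2 * s / (k - s ^ 2) - e * (2 * mu * s) * exp (c + mu * s ^ 2)).
Proof. intros Hk. auto_derive; [lra|]. simpl. field. lra. Qed.

Lemma slice_barrier_derive2 (k e c mu s : R) :
  s ^ 2 < k ->
  is_derive (fun s => 2 * s / (k - s ^ 2) - e * (2 * mu * s) * exp (c + mu * s ^ 2)) s
    (2 / (k - s ^ 2) + 4 * s ^ 2 / (k - s ^ 2) ^ 2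
     - e * (2 * mu + 4 * mu ^ 2 * s ^ 2) * exp (c + mu * s ^ 2)).
Proof. intros Hk. auto_derive; [lra|]. simpl. field. lra. Qed.

Lemma locally_sq_lt (x k : R) : x ^ 2 < k -> locally x (fun s => s ^ 2 < k).
Proof.
  apply (locally_lt (fun s : R => s ^ 2)).
  apply (ex_derive_continuous (fun a => a ^ 2)). now auto_derive.
Qed.

Lemma C2_on_slices (Rd : R) (f : pt -> R) (x y : R) :
  C2_on (open_disk Rd) f -> open_disk Rd (x, y) ->
  (locally x (fun s => is_derive (fun a => f (a, y)) s (d1 f (s, y))) /\
   is_derive (fun s => d1 f (s, y)) x (d1 (d1 f) (x, y))) /\
  (locally y (fun s => is_derive (fun a => f (x, a)) s (d2 f (x, s))) /\
   is_derive (fun s => d2 f (x, s)) y (d2 (d2 f) (x, y))).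
Proof.
  intros HC Ho.
  destruct (HC (x, y) Ho) as [Hxy _].
  unfold open_disk, nrm2 in Ho; cbn [fst snd] in Ho.
  split; split.
  - apply (filter_imp (fun s => s ^ 2 < Rd ^ 2 - y ^ 2)); [|apply locally_sq_lt; lra].
    intros s Hs. assert (Hs' : open_disk Rd (s, y)) by (unfold open_disk, nrm2; cbn [fst snd]; simpl in Hs |- *; lra).
    destruct (HC (s, y) Hs') as [Hd _].
    apply Derive_correct. exact (proj1 (Hd f (or_introl eq_refl))).
  - apply Derive_correct. exact (proj1 (Hxy (d1 f) (or_intror (or_introl eq_refl)))).
  - apply (filter_imp (fun s => s ^ 2 < Rd ^ 2 - x ^ 2)); [|apply locally_sq_lt; lra].
    intros s Hs. assert (Hs' : open_disk Rd (x, s)) by (unfold open_disk, nrm2; cbn [fst snd]; simpl in Hs |- *; lra).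
    destruct (HC (x, s) Hs') as [Hd _].
    apply Derive_correct. exact (proj2 (Hd f (or_introl eq_refl))).
  - apply Derive_correct. exact (proj2 (Hxy (d2 f) (or_intror (or_intror eq_refl)))).
Qed.

(** At a touching point the second derivatives along each axis are ordered, and the two inequalities
    add up. The slices of [- ln (k - |z|^2)] sum to [4 k / (k - |p|^2)^2], which is Liouville's
    equation for a hyperbolic factor. *)
Lemma lap_ge_of_touching_below (Rd : R) (f : pt -> R) (A k e c mu : R) (p : pt) :
  C2_on (open_disk Rd) f -> open_disk Rd p -> Rd ^ 2 <= k ->
  (forall z, open_disk Rd z -> A - ln (k - nrm2 z) - e * exp (c + mu * nrm2 z) <= f z) ->
  A - ln (k - nrm2 p) - e * exp (c + mu * nrm2 p) = f p ->
  4 * k / (k - nrm2 p) ^ 2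
    - e * (4 * mu + 4 * mu ^ 2 * nrm2 p) * exp (c + mu * nrm2 p) <= lap f p.
Proof.
  intros HC Ho Hk Hle Heq. destruct p as [x y].
  destruct (C2_on_slices Rd f x y HC Ho) as [[X1 X2] [Y1 Y2]].
  unfold open_disk, nrm2 in *; cbn [fst snd] in *.
  assert (Kx : x ^ 2 < k - y ^ 2) by lra.
  assert (Ky : y ^ 2 < k - x ^ 2) by lra.
  assert (Hx := second_derive_compare _ _ _ _ x _ _ X1 X2
    (filter_imp _ _ (slice_barrier_derive A (k - y ^ 2) e (c + mu * y ^ 2) mu)
       (locally_sq_lt x (k - y ^ 2) Kx))
    (slice_barrier_derive2 (k - y ^ 2) e (c + mu * y ^ 2) mu x Kx)).
  assert (Hy := second_derive_compare _ _ _ _ y _ _ Y1 Y2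
    (filter_imp _ _ (slice_barrier_derive A (k - x ^ 2) e (c + mu * x ^ 2) mu)
       (locally_sq_lt y (k - x ^ 2) Ky))
    (slice_barrier_derive2 (k - x ^ 2) e (c + mu * x ^ 2) mu y Ky)).
  lapply Hx; clear Hx; [intros Hx|].
  2:{ apply (filter_imp (fun s => s ^ 2 < Rd ^ 2 - y ^ 2)); [|apply locally_sq_lt; lra].
      intros s Hs. specialize (Hle (s, y)). cbn [fst snd] in Hle.
      replace (k - y ^ 2 - s ^ 2) with (k - (s ^ 2 + y ^ 2)) by ring.
      replace (c + mu * y ^ 2 + mu * s ^ 2) with (c + mu * (s ^ 2 + y ^ 2)) by ring.
      apply Hle. lra. }
  lapply Hy; clear Hy; [intros Hy|].
  2:{ apply (filter_imp (fun s => s ^ 2 < Rd ^ 2 - x ^ 2)); [|apply locally_sq_lt; lra].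
      intros s Hs. specialize (Hle (x, s)). cbn [fst snd] in Hle.
      replace (k - x ^ 2 - s ^ 2) with (k - (x ^ 2 + s ^ 2)) by ring.
      replace (c + mu * x ^ 2 + mu * s ^ 2) with (c + mu * (x ^ 2 + s ^ 2)) by ring.
      apply Hle. lra. }
  replace (k - y ^ 2 - x ^ 2) with (k - (x ^ 2 + y ^ 2)) in Hx by ring.
  replace (c + mu * y ^ 2 + mu * x ^ 2) with (c + mu * (x ^ 2 + y ^ 2)) in Hx by ring.
  replace (k - x ^ 2 - y ^ 2) with (k - (x ^ 2 + y ^ 2)) in Hy by ring.
  replace (c + mu * x ^ 2 + mu * y ^ 2) with (c + mu * (x ^ 2 + y ^ 2)) in Hy by ring.
  specialize (Hx Heq). specialize (Hy Heq).
  unfold lap.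
  replace (4 * k / (k - (x ^ 2 + y ^ 2)) ^ 2) with
    ((2 / (k - (x ^ 2 + y ^ 2)) + 4 * x ^ 2 / (k - (x ^ 2 + y ^ 2)) ^ 2)
   + (2 / (k - (x ^ 2 + y ^ 2)) + 4 * y ^ 2 / (k - (x ^ 2 + y ^ 2)) ^ 2)) by (field; lra).
  lra.
Qed.

(** The slice comparison with the roles exchanged and no weight. The case [k = Rd ^ 2] is the
    barrier that is infinite on the circle. *)
Lemma lap_le_of_touching_above (Rd : R) (f : pt -> R) (A k : R) (p : pt) :
  C2_on (open_disk Rd) f -> open_disk Rd p -> Rd ^ 2 <= k ->
  (forall z, open_disk Rd z -> f z <= A - ln (k - nrm2 z)) ->
  f p = A - ln (k - nrm2 p) ->
  lap f p <= 4 * k / (k - nrm2 p) ^ 2.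
Proof.
  intros HC Ho Hk Hle Heq. destruct p as [x y].
  destruct (C2_on_slices Rd f x y HC Ho) as [[X1 X2] [Y1 Y2]].
  unfold open_disk, nrm2 in *; cbn [fst snd] in *.
  assert (Kx : x ^ 2 < k - y ^ 2) by lra.
  assert (Ky : y ^ 2 < k - x ^ 2) by lra.
  assert (Hx := second_derive_compare _ _ _ _ x _ _
    (filter_imp _ _ (slice_barrier_derive A (k - y ^ 2) 0 0 0)
       (locally_sq_lt x (k - y ^ 2) Kx))
    (slice_barrier_derive2 (k - y ^ 2) 0 0 0 x Kx) X1 X2).
  assert (Hy := second_derive_compare _ _ _ _ y _ _
    (filter_imp _ _ (slice_barrier_derive A (k - x ^ 2) 0 0 0)
       (locally_sq_lt y (k - x ^ 2) Ky))
    (slice_barrier_derive2 (k - x ^ 2) 0 0 0 y Ky) Y1 Y2).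
  lapply Hx; clear Hx; [intros Hx|].
  2:{ apply (filter_imp (fun s => s ^ 2 < Rd ^ 2 - y ^ 2)); [|apply locally_sq_lt; lra].
      intros s Hs. specialize (Hle (s, y)). cbn [fst snd] in Hle.
      replace (k - y ^ 2 - s ^ 2) with (k - (s ^ 2 + y ^ 2)) by ring.
      rewrite Rmult_0_l, Rminus_0_r. apply Hle. lra. }
  lapply Hy; clear Hy; [intros Hy|].
  2:{ apply (filter_imp (fun s => s ^ 2 < Rd ^ 2 - x ^ 2)); [|apply locally_sq_lt; lra].
      intros s Hs. specialize (Hle (x, s)). cbn [fst snd] in Hle.
      replace (k - x ^ 2 - s ^ 2) with (k - (x ^ 2 + s ^ 2)) by ring.
      rewrite Rmult_0_l, Rminus_0_r. apply Hle. lra. }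
  replace (k - y ^ 2 - x ^ 2) with (k - (x ^ 2 + y ^ 2)) in Hx by ring.
  replace (k - x ^ 2 - y ^ 2) with (k - (x ^ 2 + y ^ 2)) in Hy by ring.
  rewrite !Rmult_0_l, !Rminus_0_r in Hx, Hy.
  specialize (Hx Heq). specialize (Hy Heq).
  unfold lap.
  replace (4 * k / (k - (x ^ 2 + y ^ 2)) ^ 2) with
    ((2 / (k - (x ^ 2 + y ^ 2)) + 4 * x ^ 2 / (k - (x ^ 2 + y ^ 2)) ^ 2)
   + (2 / (k - (x ^ 2 + y ^ 2)) + 4 * y ^ 2 / (k - (x ^ 2 + y ^ 2)) ^ 2)) by (field; lra).
  lra.
Qed.

(** * Comparison with barriers *)

Definition cylinder (a b Rd : R) (v : R * pt) : Prop :=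
  a <= fst v <= b /\ closed_disk Rd (snd v).

Lemma cylinder_max (a b Rd : R) (f : R * pt -> R) :
  a <= b -> 0 <= Rd -> continuous_on (cylinder a b Rd) f ->
  exists u, cylinder a b Rd u /\ forall v, cylinder a b Rd v -> f v <= f u.
Proof.
  intros Hab HR Hf.
  apply (compact_max (cylinder a b Rd) (Rabs a + Rabs b + Rd) f); [| | |exact Hf].
  - exists (a, (0, 0)). unfold cylinder, closed_disk, nrm2; cbn [fst snd]. nra.
  - intros [t [x y]] [Ht Hp]. unfold closed_disk, nrm2 in Hp. cbn [fst snd] in *.
    pose proof (Rabs_pos a). pose proof (Rabs_pos b).
    split; [|split; apply Rabs_le; nra].
    apply Rabs_le. pose proof (Rle_abs b). pose proof (Rle_abs (- a)). rewrite Rabs_Ropp in *. lra.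
  - apply closed_and; [apply closed_and|].
    + apply (closed_comp fst (fun t : R => a <= t)); [intros u; apply continuous_fst|apply closed_ge].
    + apply (closed_comp fst (fun t : R => t <= b)); [intros u; apply continuous_fst|apply closed_le].
    + apply (closed_comp (fun u : R * pt => nrm2 (snd u)) (fun t : R => t <= Rd ^ 2)); [|apply closed_le].
      intros u. apply (continuous_comp snd nrm2); [apply continuous_snd|apply continuous_nrm2].
Qed.

Lemma continuous_on_intro {T U : UniformSpace} (K : T -> Prop) (f : T -> U) :
  (forall u, K u -> continuous f u) -> continuous_on K f.
Proof.
  intros H u Ku. apply (filterlim_filter_le_1 (F := locally u)); [apply filter_le_within|exact (H u Ku)].
Qed.

Lemma continuous_on_mult {T : UniformSpace} (K : T -> Prop) (f g : T -> R) :
  continuous_on K f -> continuous_on K g -> continuous_on K (fun v => f v * g v).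
Proof.
  intros Hf Hg u Ku.
  apply (@filterlim_comp_2 _ _ _ _ _ (locally (f u)) (locally (g u)) _ _ f g Rmult (Hf u Ku) (Hg u Ku)).
  exact (@filterlim_mult R_AbsRing (f u) (g u)).
Qed.

Lemma continuous_on_plus {T : UniformSpace} (K : T -> Prop) (f g : T -> R) :
  continuous_on K f -> continuous_on K g -> continuous_on K (fun v => f v + g v).
Proof.
  intros Hf Hg u Ku.
  apply (@filterlim_comp_2 _ _ _ _ _ (locally (f u)) (locally (g u)) _ _ f g Rplus (Hf u Ku) (Hg u Ku)).
  exact (@filterlim_plus R_AbsRing R_NormedModule (f u) (g u)).
Qed.

Lemma continuous_on_post {T : UniformSpace} (K : T -> Prop) (f : T -> R) (g : R -> R) :
  continuous_on K f -> (forall x, continuous g x) -> continuous_on K (fun v => g (f v)).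
Proof.
  intros Hf Hg u Ku. exact (filterlim_comp _ _ _ f g _ _ _ (Hf u Ku) (Hg (f u))).
Qed.

Lemma ball_radius_pos (r0 : R) : 0 < r0 -> 0 < ball_radius r0.
Proof.
  intros H. unfold ball_radius, tanh, sinh, cosh.
  assert (exp (- (r0 / 2)) < exp (r0 / 2)) by (apply exp_increasing; lra).
  pose proof (exp_pos (- (r0 / 2))).
  apply Rdiv_lt_0_compat; lra.
Qed.

Lemma ball_radius_lt_1 (r0 : R) : ball_radius r0 < 1.
Proof.
  unfold ball_radius, tanh, sinh, cosh.
  pose proof (exp_pos (- (r0 / 2))). pose proof (exp_pos (r0 / 2)).
  apply (Rmult_lt_reg_r ((exp (r0 / 2) + exp (- (r0 / 2))) / 2)); [lra|].
  field_simplify; [|lra]. lra.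
Qed.

Lemma solution_continuous_on (r0 m : R) (eta : R -> R) (W : R -> pt -> R) (a b : R) :
  classical_solution r0 m eta W -> 0 <= a ->
  continuous_on (cylinder a b (ball_radius r0)) (fun v => W (fst v) (snd v)).
Proof.
  intros [Hc _] Ha.
  apply (continuous_on_subset (fun q : R * pt => 0 <= fst q /\ closed_disk (ball_radius r0) (snd q))).
  - intros [t p] [Ht Hp]. cbn [fst snd] in *. split; [lra|exact Hp].
  - intros [t p] [Ht Hp]. exact (Hc t p Ht Hp).
Qed.

Lemma continuous_nrm2_snd (u : R * pt) : continuous (fun v : R * pt => nrm2 (snd v)) u.
Proof. apply (continuous_comp snd nrm2); [apply continuous_snd|apply continuous_nrm2]. Qed.

Lemma solution_flow_eq (r0 m : R) (eta : R -> R) (W : R -> pt -> R) (t : R) (p : pt) :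
  classical_solution r0 m eta W -> 0 < t -> open_disk (ball_radius r0) p ->
  is_derive (fun s => W s p) t (exp (-2 * W t p) * lap (W t) p - 1).
Proof.
  intros [_ [_ [Hpde _]]] Ht Hp. destruct (Hpde t p Ht Hp) as [Hex [_ Heq]].
  replace (exp (-2 * W t p) * lap (W t) p - 1) with (dt W t p).
  - apply Derive_correct, Hex.
  - rewrite Heq. unfold gauss_curv. ring.
Qed.

(** Maximise the ratio [F] of the metric to the barrier. A maximum [N > 1] cannot lie on the circle,
    where [F = 0], nor at time 0. At an interior point the barrier multiplied by [N] touches from
    above, but its curvature is [N] times smaller in absolute value, too small for the rate
    prescribed by the flow. *)
Lemma upper_barrier (r0 m eps : R) (eta : R -> R) (W : R -> pt -> R) (t : R) (p : pt) :
  0 < r0 -> 0 < m -> 0 < eps -> classical_solution r0 m eta W ->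
  0 <= t -> open_disk (ball_radius r0) p ->
  exp (2 * W t p) * (ball_radius r0 ^ 2 - nrm2 p) ^ 2
    <= 4 * ball_radius r0 ^ 2 * (1 + eps + m * exp (-2 * t)).
Proof.
  intros Hr0 Hm Heps Hsol Ht Hp.
  pose proof (ball_radius_pos r0 Hr0) as HR. pose proof (ball_radius_lt_1 r0) as HR1.
  set (Rd := ball_radius r0) in *.
  (* [kap' = 2 (1 + eps) - 2 kap], whereas an exact multiple of a hyperbolic metric evolves by
     [kap' = 2 - 2 kap]. Also [kap 0 > m]. *)
  set (kap := fun s : R => 1 + eps + m * exp (-2 * s)).
  assert (Hk : forall s, 0 < 4 * Rd ^ 2 * kap s).
  { intros s. unfold kap. pose proof (exp_pos (-2 * s)). apply Rmult_lt_0_compat; nra. }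
  set (F := fun v : R * pt => exp (2 * W (fst v) (snd v)) *
    ((Rd ^ 2 - nrm2 (snd v)) ^ 2 * / (4 * Rd ^ 2 * kap (fst v)))).
  destruct (cylinder_max 0 t Rd F) as [[s z] [[Hs Hz] Hmax]]; [exact Ht|lra| |].
  { apply continuous_on_mult.
    - apply (continuous_on_post _ _ (fun w => exp (2 * w))).
      + apply (solution_continuous_on r0 m eta W 0 t Hsol). lra.
      + intros w. apply (ex_derive_continuous (fun w => exp (2 * w))). now auto_derive.
    - apply continuous_on_mult; apply continuous_on_intro; intros u Hu.
      + apply (continuous_comp (fun v : R * pt => nrm2 (snd v)) (fun w => (Rd ^ 2 - w) ^ 2)).
        * apply continuous_nrm2_snd.
        * apply (ex_derive_continuous (fun w => (Rd ^ 2 - w) ^ 2)). now auto_derive.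
      + apply (continuous_comp fst (fun w => / (4 * Rd ^ 2 * kap w))).
        * apply continuous_fst.
        * apply (ex_derive_continuous (fun w => / (4 * Rd ^ 2 * kap w))).
          specialize (Hk (fst u)). unfold kap in *. auto_derive. apply Rgt_not_eq, Hk. }
  cbn [fst snd] in Hs, Hz.
  assert (Hdom : cylinder 0 t Rd (t, p)).
  { unfold cylinder, closed_disk; cbn [fst snd]. split; [lra|apply Rlt_le, Hp]. }
  destruct (Rle_or_lt (F (s, z)) 1) as [Hle|Hgt].
  { specialize (Hmax _ Hdom). unfold F in Hmax at 1; cbn [fst snd] in Hmax.
    specialize (Hk t). unfold kap in Hk at 1.
    apply (Rmult_le_reg_r (/ (4 * Rd ^ 2 * kap t))); [apply Rinv_0_lt_compat, Hk|].
    rewrite Rmult_assoc. change (1 + eps + m * exp (-2 * t)) with (kap t).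
    rewrite (Rinv_r (4 * Rd ^ 2 * kap t)); [lra|]. apply Rgt_not_eq, Hk. }
  exfalso.
  assert (Hzo : open_disk Rd z).
  { destruct (Rle_lt_or_eq_dec _ _ Hz) as [|Hz']; [assumption|].
    unfold F in Hgt; cbn [fst snd] in Hgt. rewrite Hz' in Hgt. exfalso.
    replace (Rd ^ 2 - Rd ^ 2) with 0 in Hgt by ring. simpl in Hgt. lra. }
  unfold open_disk in Hzo. pose proof (nrm2_nonneg z) as Hz0.
  set (N := F (s, z)) in *.
  assert (Hs0 : 0 < s).
  { destruct (Rle_lt_or_eq_dec 0 s ltac:(lra)) as [|Hs0]; [assumption|exfalso].
    destruct Hsol as [_ [_ [_ [_ Hinit]]]].
    unfold N, F in Hgt; cbn [fst snd] in Hgt. rewrite <- Hs0 in Hgt.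
    rewrite (Hinit z Hz) in Hgt. unfold hyp_factor in Hgt.
    assert (Hq : 0 < 2 / (1 - nrm2 z)) by (apply Rdiv_lt_0_compat; nra).
    replace (exp (2 * (ln m / 2 + ln (2 / (1 - nrm2 z))))) with (m * (2 / (1 - nrm2 z)) ^ 2) in Hgt.
    2:{ replace (2 * (ln m / 2 + ln (2 / (1 - nrm2 z)))) with
         (ln m + (ln (2 / (1 - nrm2 z)) + ln (2 / (1 - nrm2 z)))) by field.
        rewrite !exp_plus, !exp_ln by assumption. ring. }
    specialize (Hk 0).
    assert (Hlt : 4 * Rd ^ 2 * kap 0 < m * (2 / (1 - nrm2 z)) ^ 2 * (Rd ^ 2 - nrm2 z) ^ 2).
    { apply (Rmult_lt_reg_r (/ (4 * Rd ^ 2 * kap 0))); [apply Rinv_0_lt_compat, Hk|].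
      rewrite Rinv_r by (apply Rgt_not_eq, Hk). lra. }
    unfold kap in Hlt. rewrite Rmult_0_r, exp_0 in Hlt.
    (* With [Y] this quotient, the ratio at time 0 is [m Y^2 / (Rd^2 kap 0)], so [Y <= Rd] leaves at
       most [m / kap 0 < 1]. *)
    assert (Hy : 0 <= (Rd ^ 2 - nrm2 z) / (1 - nrm2 z) <= Rd).
    { split; [apply Rdiv_le_0_compat; nra|]. apply Rle_div_l; nra. }
    replace (m * (2 / (1 - nrm2 z)) ^ 2 * (Rd ^ 2 - nrm2 z) ^ 2) with
      (4 * m * ((Rd ^ 2 - nrm2 z) / (1 - nrm2 z)) ^ 2) in Hlt by (field; nra).
    set (Y := (Rd ^ 2 - nrm2 z) / (1 - nrm2 z)) in *.
    assert (Y ^ 2 <= Rd ^ 2) by nra. nra. }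
  set (A := fun s => ln (N * (4 * Rd ^ 2 * kap s)) / 2).
  assert (Habove : forall s' z', 0 <= s' <= t -> open_disk Rd z' ->
     W s' z' <= A s' - ln (Rd ^ 2 - nrm2 z')).
  { intros s' z' Hs' Hz'. unfold open_disk in Hz'.
    assert (Hle : F (s', z') <= N).
    { apply Hmax. unfold cylinder, closed_disk; cbn [fst snd]. lra. }
    unfold F in Hle; cbn [fst snd] in Hle. specialize (Hk s').
    assert (Hle2 : exp (2 * W s' z') * (Rd ^ 2 - nrm2 z') ^ 2 <= N * (4 * Rd ^ 2 * kap s')).
    { apply (Rmult_le_reg_r (/ (4 * Rd ^ 2 * kap s'))); [apply Rinv_0_lt_compat, Hk|].
      rewrite (Rmult_assoc N), Rinv_r by (apply Rgt_not_eq, Hk). lra. }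
    apply ln_le in Hle2.
    2:{ apply Rmult_lt_0_compat; [apply exp_pos|]. apply pow_lt. lra. }
    rewrite ln_mult, ln_exp in Hle2; [|apply exp_pos|apply pow_lt; lra].
    replace ((Rd ^ 2 - nrm2 z') ^ 2) with ((Rd ^ 2 - nrm2 z') * (Rd ^ 2 - nrm2 z')) in Hle2 by ring.
    rewrite ln_mult in Hle2 by lra. unfold A. lra. }
  assert (Hat : W s z = A s - ln (Rd ^ 2 - nrm2 z)).
  { unfold A. specialize (Hk s).
    replace (N * (4 * Rd ^ 2 * kap s)) with (exp (2 * W s z) * ((Rd ^ 2 - nrm2 z) * (Rd ^ 2 - nrm2 z))).
    - rewrite !ln_mult, ln_exp; try lra; try apply exp_pos. nra.
    - unfold N, F; cbn [fst snd]. field. split; [|lra]. intros H0. rewrite H0 in Hk. lra. }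
  assert (Hlap := lap_le_of_touching_above Rd (W s) (A s) (Rd ^ 2) z
    (proj1 (proj2 Hsol) s Hs0) Hzo ltac:(lra) (fun z' => Habove s z' Hs) Hat).
  assert (Hdt := solution_flow_eq r0 m eta W s z Hsol Hs0 Hzo).
  assert (HdA : is_derive A s ((1 + eps - kap s) / kap s)).
  { specialize (Hk s). assert (Hks : 0 < kap s) by nra. unfold A, kap. auto_derive.
    - apply Rmult_lt_0_compat; [lra|exact Hk].
    - unfold kap in Hks. field. repeat split; lra. }
  assert (Htime : (1 + eps - kap s) / kap s - (exp (-2 * W s z) * lap (W s) z - 1) <= 0).
  { apply (derive_nonpos_of_left_min (fun s => A s - W s z) s _ 0 Hs0).
    - exact (is_derive_minus A (fun s => W s z) s _ _ HdA Hdt).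
    - intros s' Hs'. specialize (Habove s' z ltac:(lra) Hzo). lra. }
  assert (Hks : 0 < kap s) by (specialize (Hk s); nra).
  assert (He : exp (-2 * W s z) * (4 * Rd ^ 2 / (Rd ^ 2 - nrm2 z) ^ 2) = / (N * kap s)).
  { rewrite Hat. unfold A.
    replace (-2 * (ln (N * (4 * Rd ^ 2 * kap s)) / 2 - ln (Rd ^ 2 - nrm2 z))) with
      (- ln (N * (4 * Rd ^ 2 * kap s)) + (ln (Rd ^ 2 - nrm2 z) + ln (Rd ^ 2 - nrm2 z))) by field.
    rewrite !exp_plus, exp_Ropp, !exp_ln; [|lra|apply Rmult_lt_0_compat; [lra|apply Hk]].
    field. repeat split; nra. }
  assert (Hupper : exp (-2 * W s z) * lap (W s) z <= / (N * kap s)).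
  { rewrite <- He. apply Rmult_le_compat_l; [apply Rlt_le, exp_pos|exact Hlap]. }
  (* The time and space conditions at the touching point combine to
     [(1 + eps) / kap <= / (N * kap)], which [N > 1] excludes. *)
  assert (Hlt : / (N * kap s) < / kap s) by (apply Rinv_lt_contravar; nra).
  replace ((1 + eps - kap s) / kap s) with ((1 + eps) * / kap s - 1) in Htime by (field; lra).
  pose proof (Rinv_0_lt_compat _ Hks). nra.
Qed.

(** Along the radius through [p] the barrier stays below [f] and meets it at the circle, so the
    inward difference quotients of [f] are at most those of the barrier. *)
Lemma outward_deriv_le (Rd e c mu k A dn : R) (f : pt -> R) (p : pt) :
  0 < Rd -> Rd ^ 2 < k -> on_circle Rd p -> outward_deriv f p dn ->
  (forall z, open_disk Rd z -> A - ln (k - nrm2 z) - e * exp (c + mu * nrm2 z) <= f z) ->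
  A - ln (k - nrm2 p) - e * exp (c + mu * nrm2 p) = f p ->
  dn <= 2 * Rd / (k - Rd ^ 2) - 2 * mu * Rd * (e * exp (c + mu * Rd ^ 2)).
Proof.
  intros HR Hk Hp Hdn Hle Heq. unfold on_circle in Hp.
  set (h := fun s : R => A - ln (k - s ^ 2 * Rd ^ 2) - e * exp (c + mu * (s ^ 2 * Rd ^ 2))).
  assert (Hh : is_derive h 1 (2 * Rd ^ 2 / (k - Rd ^ 2)
      - 2 * mu * Rd ^ 2 * (e * exp (c + mu * Rd ^ 2)))).
  { unfold h. auto_derive.
    - simpl in Hk |- *. nra.
    - simpl. replace (Rd * (Rd * 1)) with (Rd ^ 2) by ring.
      replace (1 * (1 * 1) * Rd ^ 2) with (Rd ^ 2) by ring. field. lra. }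
  assert (Hlim := left_quotient_lim h _ Hh).
  assert (Hlim2 : filterlim (fun s => / Rd * ((h 1 - h s) / (1 - s))) (at_left 1)
     (locally (/ Rd * (2 * Rd ^ 2 / (k - Rd ^ 2) - 2 * mu * Rd ^ 2 * (e * exp (c + mu * Rd ^ 2)))))).
  { apply (filterlim_comp _ _ _ _ (fun x => / Rd * x) _ _ _ Hlim).
    apply (ex_derive_continuous (fun x => / Rd * x)). now auto_derive. }
  assert (Hsq : sqrt (nrm2 p) = Rd).
  { rewrite Hp. replace (Rd ^ 2) with (Rd * Rd) by ring. apply sqrt_square. lra. }
  replace (2 * Rd / (k - Rd ^ 2) - 2 * mu * Rd * (e * exp (c + mu * Rd ^ 2))) with
    (/ Rd * (2 * Rd ^ 2 / (k - Rd ^ 2) - 2 * mu * Rd ^ 2 * (e * exp (c + mu * Rd ^ 2))))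
    by (field; lra).
  apply (filterlim_le (F := at_left 1)
    (fun s => (f p - f (s * fst p, s * snd p)) / ((1 - s) * sqrt (nrm2 p)))
    (fun s => / Rd * ((h 1 - h s) / (1 - s))) (Finite dn) (Finite _)); [|exact Hdn|exact Hlim2].
  enough (Hle' : forall s : R, 0 < s < 1 ->
    (f p - f (s * fst p, s * snd p)) / ((1 - s) * sqrt (nrm2 p)) <= / Rd * ((h 1 - h s) / (1 - s))).
  { exists (mkposreal 1 Rlt_0_1). intros s Hs Hs1. apply Hle'.
    change (Rabs (s - 1) < 1) in Hs. apply Rabs_def2 in Hs. split; [lra|exact Hs1]. }
  intros s Hs.
  assert (Hn : nrm2 (s * fst p, s * snd p) = s ^ 2 * Rd ^ 2).
  { rewrite <- Hp. unfold nrm2; cbn [fst snd]. ring. }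
  specialize (Hle (s * fst p, s * snd p)). unfold open_disk in Hle. rewrite Hn in Hle.
  rewrite Hp in Heq. rewrite Hsq.
  assert (Hh1 : h 1 = f p).
  { rewrite <- Heq. unfold h. replace (1 ^ 2 * Rd ^ 2) with (Rd ^ 2) by ring. reflexivity. }
  assert (Hhs : h s <= f (s * fst p, s * snd p)).
  { apply Hle. assert (s ^ 2 < 1) by (simpl; nra). assert (0 < Rd ^ 2) by (apply pow_lt; lra). nra. }
  replace (/ Rd * ((h 1 - h s) / (1 - s))) with ((h 1 - h s) / ((1 - s) * Rd)) by (field; lra).
  rewrite Hh1. apply Rmult_le_compat_r; [|lra].
  apply Rlt_le, Rinv_0_lt_compat. apply Rmult_lt_0_compat; lra.
Qed.

(* The boundary condition [dn W = eta e^W - 1/Rd] has the unfavourable sign for a maximum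
   principle; the weight [exp (lam t + mu |p|^2)] absorbs it: [mu] large beats [eta e^V] on the
   circle, then [lam] large beats the Laplacian of the weight inside. *)
Lemma lower_barrier (r0 m t0 tau B : R) (eta a q a' q' : R -> R) (W : R -> pt -> R) :
  let Rd := ball_radius r0 in
  0 < r0 -> 0 <= t0 <= tau -> classical_solution r0 m eta W ->
  (forall t, t0 <= t <= tau -> is_derive a t (a' t)) ->
  (forall t, t0 <= t <= tau -> is_derive q t (q' t)) ->
  (forall t, t0 <= t <= tau -> Rd ^ 2 < q t) ->
  (forall t, t0 <= t <= tau -> 0 <= eta t <= B) ->
  (forall t, t0 <= t <= tau -> exp (- a t) * (q t + Rd ^ 2) / Rd <= eta t) ->
  (forall t p, t0 <= t <= tau -> open_disk Rd p ->
     a' t - q' t / (q t - nrm2 p) <= exp (- a t) ^ 2 * (4 * q t) - 1) ->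
  (forall p, closed_disk Rd p -> a t0 - ln (q t0 - nrm2 p) <= W t0 p) ->
  forall t p, t0 <= t <= tau -> closed_disk Rd p -> a t - ln (q t - nrm2 p) <= W t p.
Proof.
  intros Rd Hr0 Ht0 Hsol Ha Hq HqR Heta Hbd Hint Hinit t p Ht Hp.
  pose proof (ball_radius_pos r0 Hr0) as HR. fold Rd in HR.
  assert (HB : 0 <= B) by (specialize (Heta t Ht); lra).
  destruct (continuity_ab_maj (fun s => exp (a s) / (q s - Rd ^ 2)) t0 tau) as [sM [HsM HsM']];
    [lra| |].
  { intros s Hs. apply continuity_pt_filterlim.
    apply (ex_derive_continuous (fun s => exp (a s) / (q s - Rd ^ 2))).
    specialize (HqR s Hs). auto_derive.
    repeat split; [eexists; apply Ha, Hs|eexists; apply Hq, Hs|simpl in HqR |- *; lra]. }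
  (* Write [V] for the barrier [a - ln (q - |p|^2)]. Then [M] bounds [eta e^V] on the circle over
     the whole time interval. *)
  set (M := B * (exp (a sM) / (q sM - Rd ^ 2))).
  assert (HM : 0 <= M).
  { unfold M. apply Rmult_le_pos; [lra|]. apply Rdiv_le_0_compat; [apply Rlt_le, exp_pos|].
    specialize (HqR sM HsM'). lra. }
  (* The logarithm of the weight has normal derivative [2 mu Rd] on the circle; this makes it
     [M + 1], one more than the term to be absorbed. *)
  set (mu := (M + 1) / (2 * Rd)).
  assert (Hmu : 2 * mu * Rd = M + 1) by (unfold mu; field; lra).
  assert (Hmu0 : 0 < mu) by nra.
  assert (HWc := solution_continuous_on r0 m eta W t0 tau Hsol (proj1 Ht0)). fold Rd in HWc.
  destruct (cylinder_max t0 tau Rd (fun v => exp (-2 * W (fst v) (snd v)))) as [u0 [_ Hu0]]; [lra|lra| |].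
  { apply (continuous_on_post _ _ (fun w => exp (-2 * w)) HWc). intros w.
    apply (ex_derive_continuous (fun w => exp (-2 * w))). now auto_derive. }
  set (C := exp (-2 * W (fst u0) (snd u0))) in *.
  assert (HC : 0 < C) by apply exp_pos.
  (* [C] bounds [e^(-2W)], so the product bounds [e^(-2W)] times the Laplacian of the weight,
     relative to the weight. The [+ 1] is the strict margin that gives the contradiction. *)
  set (lam := C * (4 * mu + 4 * mu ^ 2 * Rd ^ 2) + 1).
  set (D := fun v : R * pt => W (fst v) (snd v) + - (a (fst v) - ln (q (fst v) - nrm2 (snd v)))).
  set (G := fun v : R * pt => D v * - exp (- (lam * fst v + mu * nrm2 (snd v)))).
  assert (Hgap : forall v, cylinder t0 tau Rd v -> 0 < q (fst v) - nrm2 (snd v)).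
  { intros [s z] [Hs Hz]; unfold closed_disk in Hz; cbn [fst snd] in *.
    specialize (HqR s Hs). lra. }
  destruct (cylinder_max t0 tau Rd G) as [[s z] [[Hs Hz] Hmax]]; [lra|lra| |].
  { apply continuous_on_mult; [apply (continuous_on_plus _ _ _ HWc)|]; apply continuous_on_intro; intros u Hu.
    - apply (continuous_opp (V := R_NormedModule) (fun v : R * pt => a (fst v) - ln (q (fst v) - nrm2 (snd v)))).
      apply (continuous_minus (V := R_NormedModule) (fun v : R * pt => a (fst v))).
      + apply (continuous_comp fst a); [apply continuous_fst|].
        apply (ex_derive_continuous a). eexists. apply Ha, Hu.
      + apply (continuous_comp (fun v : R * pt => q (fst v) - nrm2 (snd v)) ln).
        * apply (continuous_minus (V := R_NormedModule) (fun v : R * pt => q (fst v))).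
          -- apply (continuous_comp fst q); [apply continuous_fst|].
             apply (ex_derive_continuous q). eexists. apply Hq, Hu.
          -- apply continuous_nrm2_snd.
        * apply (ex_derive_continuous ln). eexists. apply is_derive_ln, Hgap, Hu.
    - apply (continuous_comp (fun v : R * pt => lam * fst v + mu * nrm2 (snd v)) (fun w => - exp (- w))).
      + apply (continuous_plus (V := R_NormedModule) (fun v : R * pt => lam * fst v)).
        * apply (continuous_comp fst (fun w => lam * w)); [apply continuous_fst|].
          apply (ex_derive_continuous (fun w => lam * w)). now auto_derive.
        * apply (continuous_comp (fun v : R * pt => nrm2 (snd v)) (fun w => mu * w)); [apply continuous_nrm2_snd|].
          apply (ex_derive_continuous (fun w => mu * w)). now auto_derive.
      + apply (ex_derive_continuous (fun w => - exp (- w))). now auto_derive. }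
  cbn [fst snd] in Hs, Hz.
  destruct (Rle_or_lt (a t - ln (q t - nrm2 p)) (W t p)) as [|Hneg]; [assumption|exfalso].
  (* [e] is the least coefficient for which [V] minus [e] times the weight stays below [W]; if the
     claim fails it is positive, and contact occurs at [(s, z)]. *)
  set (e := G (s, z)) in *.
  assert (He : 0 < e).
  { apply Rlt_le_trans with (G (t, p)).
    - unfold G, D; cbn [fst snd]. pose proof (exp_pos (- (lam * t + mu * nrm2 p))). nra.
    - apply Hmax. split; assumption. }
  assert (Hbelow : forall s' z', t0 <= s' <= tau -> closed_disk Rd z' ->
    a s' - ln (q s' - nrm2 z') - e * exp (lam * s' + mu * nrm2 z') <= W s' z').
  { intros s' z' Hs' Hz'.
    assert (Hle : G (s', z') <= e) by (apply Hmax; split; assumption).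
    unfold G in Hle; cbn [fst snd] in Hle.
    apply (Rmult_le_compat_r (exp (lam * s' + mu * nrm2 z'))) in Hle; [|apply Rlt_le, exp_pos].
    replace (D (s', z') * - exp (- (lam * s' + mu * nrm2 z')) * exp (lam * s' + mu * nrm2 z'))
      with (- D (s', z')) in Hle.
    - unfold D in Hle; cbn [fst snd] in Hle. lra.
    - rewrite exp_Ropp. field. apply Rgt_not_eq, exp_pos. }
  assert (Hat : a s - ln (q s - nrm2 z) - e * exp (lam * s + mu * nrm2 z) = W s z).
  { unfold e, G, D; cbn [fst snd]. rewrite exp_Ropp. field. apply Rgt_not_eq, exp_pos. }
  set (E := e * exp (lam * s + mu * nrm2 z)) in *.
  assert (HE : 0 < E) by (apply Rmult_lt_0_compat; [exact He|apply exp_pos]).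
  assert (Hs0 : t0 < s).
  { destruct (Rle_lt_or_eq_dec t0 s ltac:(lra)) as [|Heqs]; [assumption|exfalso].
    specialize (Hinit z Hz). rewrite <- Heqs in Hat. lra. }
  assert (Hspos : 0 < s) by lra.
  assert (Hqs := HqR s Hs). unfold closed_disk in Hz.
  destruct (Rle_lt_or_eq_dec _ _ Hz) as [Hzo|Hzc].
  - assert (Hlap := lap_ge_of_touching_below Rd (W s) (a s) (q s) e (lam * s) mu z
      (proj1 (proj2 Hsol) s Hspos) Hzo (Rlt_le _ _ Hqs)
      (fun z' Hz' => Hbelow s z' Hs (Rlt_le _ _ Hz')) Hat).
    assert (Hdt := solution_flow_eq r0 m eta W s z Hsol Hspos Hzo).
    assert (Htime : exp (-2 * W s z) * lap (W s) z - 1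
        - (a' s - q' s / (q s - nrm2 z) - lam * E) <= 0).
    { apply (derive_nonpos_of_left_min
        (fun s' => W s' z - (a s' - ln (q s' - nrm2 z) - e * exp (lam * s' + mu * nrm2 z))) s _ t0 Hs0).
      - apply (is_derive_minus (fun s' => W s' z) _ s _ _ Hdt).
        assert (Ha' := Ha s Hs). assert (Hq' := Hq s Hs).
        auto_derive.
        + repeat split; [eexists; exact Ha'|eexists; exact Hq'|lra].
        + rewrite (is_derive_unique (fun x : R => a x) _ _ Ha'), (is_derive_unique (fun x : R => q x) _ _ Hq').
          unfold E. field. lra.
      - intros s' Hs'. specialize (Hbelow s' z ltac:(lra) (Rlt_le _ _ Hzo)). unfold E in Hat. lra. }
    replace (e * (4 * mu + 4 * mu ^ 2 * nrm2 z) * exp (lam * s + mu * nrm2 z))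
      with (E * (4 * mu + 4 * mu ^ 2 * nrm2 z)) in Hlap by (unfold E; ring).
    specialize (Hint s z Hs Hzo).
    assert (HCW : exp (-2 * W s z) <= C).
    { apply (Hu0 (s, z)). split; assumption. }
    set (w := exp (-2 * W s z)) in *.
    assert (Hw : 0 < w) by apply exp_pos.
    (* At the contact point [W < V], so [e^(-2W)] exceeds [e^(-2V)]. As the Laplacian of [V] is
       positive, replacing one by the other loses nothing, and the nonlinear term needs no
       linearisation. *)
    assert (HwV : exp (- a s) ^ 2 * (q s - nrm2 z) ^ 2 <= w).
    { replace (exp (- a s) ^ 2 * (q s - nrm2 z) ^ 2) with (exp (-2 * (a s - ln (q s - nrm2 z)))).
      - unfold w. apply Rlt_le, exp_increasing. lra.
      - replace (-2 * (a s - ln (q s - nrm2 z))) with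
          (- a s + - a s + (ln (q s - nrm2 z) + ln (q s - nrm2 z))) by ring.
        rewrite !exp_plus, exp_ln by lra. ring. }
    pose proof (nrm2_nonneg z) as Hz0.
    assert (HL : 0 < 4 * q s / (q s - nrm2 z) ^ 2).
    { apply Rdiv_lt_0_compat; [nra|]. apply pow_lt. lra. }
    assert (HVL : exp (- a s) ^ 2 * (4 * q s) <= w * (4 * q s / (q s - nrm2 z) ^ 2)).
    { replace (exp (- a s) ^ 2 * (4 * q s)) with
        (exp (- a s) ^ 2 * (q s - nrm2 z) ^ 2 * (4 * q s / (q s - nrm2 z) ^ 2)) by (field; lra).
      apply Rmult_le_compat_r; lra. }
    assert (Hwl := Rmult_le_compat_l w _ _ (Rlt_le _ _ Hw) Hlap).
    set (P := 4 * mu + 4 * mu ^ 2 * nrm2 z) in *.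
    assert (HP : 0 <= P <= 4 * mu + 4 * mu ^ 2 * Rd ^ 2).
    { unfold P. pose proof (pow2_ge_0 mu). split; nra. }
    assert (HwP : w * P <= C * (4 * mu + 4 * mu ^ 2 * Rd ^ 2)).
    { apply Rmult_le_compat; lra. }
    assert (HEP := Rmult_le_compat_l E _ _ (Rlt_le _ _ HE) HwP).
    unfold lam in Htime. nra.
  (* On the circle the weight lowers the normal derivative by [(M + 1) E], while [eta e^W] drops
     below [eta e^V] by at most [M E], because [e^(-E) >= 1 - E]. *)
  - destruct Hsol as [_ [_ [_ [Hgeo _]]]].
    destruct (Hgeo s z Hspos Hzc) as [dn [Hdn Hk]]. fold Rd in Hk. unfold geod_curv_circle in Hk.
    assert (Hle := outward_deriv_le Rd e (lam * s) mu (q s) (a s) dn (W s) z HR Hqs Hzc Hdn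
      (fun z' Hz' => Hbelow s z' Hs (Rlt_le _ _ Hz')) Hat).
    rewrite <- Hzc in Hle at 2. fold E in Hle.
    specialize (Hbd s Hs). specialize (Heta s Hs). specialize (HsM s Hs). simpl in HsM.
    set (V := exp (a s) / (q s - Rd ^ 2)).
    assert (HV : 0 < V) by (apply Rdiv_lt_0_compat; [apply exp_pos|lra]).
    assert (HetaV : eta s * V <= M).
    { unfold M. apply Rmult_le_compat; [lra|lra|lra|]. exact HsM. }
    assert (HWV : V * (1 - E) <= exp (W s z)).
    { rewrite <- Hat, Hzc.
      replace (a s - ln (q s - Rd ^ 2) - E) with (a s + - ln (q s - Rd ^ 2) + - E) by ring.
      rewrite !exp_plus, exp_Ropp, exp_ln by lra.
      apply Rmult_le_compat_l; [exact (Rlt_le _ _ HV)|]. pose proof (exp_ineq1_le (- E)). lra. }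
    assert (Hdn2 : / Rd + dn = eta s * exp (W s z)).
    { rewrite <- Hk. rewrite exp_Ropp. field. split; [lra|apply Rgt_not_eq, exp_pos]. }
    assert (HkV : / Rd + 2 * Rd / (q s - Rd ^ 2) <= eta s * V).
    { replace (/ Rd + 2 * Rd / (q s - Rd ^ 2)) with (exp (- a s) * (q s + Rd ^ 2) / Rd * V).
      - apply Rmult_le_compat_r; lra.
      - unfold V. rewrite exp_Ropp. field. split; [lra|split; [lra|apply Rgt_not_eq, exp_pos]]. }
    assert (Hf := Rmult_le_compat_l (eta s) _ _ (proj1 Heta) HWV).
    rewrite Hmu in Hle. nra.
Qed.

(** * The complete hyperbolic metric of a disk *)

(** Conformal factor of the pull-back of the Poincare metric of the unit disk under division by
    [Rd]. *)
Definition disk_factor (Rd : R) (p : pt) : R := ln (2 * Rd / (Rd ^ 2 - nrm2 p)).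

Lemma locally_open_disk (Rd : R) (p : pt) : open_disk Rd p -> locally p (open_disk Rd).
Proof. intros Hp. exact (locally_lt nrm2 (Rd ^ 2) p (continuous_nrm2 p) Hp). Qed.

Lemma locally_open_disk_slices (Rd : R) (p : pt) : open_disk Rd p ->
  locally (fst p) (fun a => open_disk Rd (a, snd p)) /\
  locally (snd p) (fun b => open_disk Rd (fst p, b)).
Proof.
  destruct p as [x y]. unfold open_disk, nrm2; cbn [fst snd]. intros Hp. split.
  - apply (filter_imp (fun s => s ^ 2 < Rd ^ 2 - y ^ 2)); [|apply locally_sq_lt; lra].
    intros s Hs. lra.
  - apply (filter_imp (fun s => s ^ 2 < Rd ^ 2 - x ^ 2)); [|apply locally_sq_lt; lra].
    intros s Hs. lra.
Qed.

(** Closed formulas for partial derivatives hold only inside the disk, so second partials are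
    computed by replacing [d1 f] and [d2 f] by their formulas near the point, along each axis. *)
Lemma partials_of_eq_on_disk (Rd : R) (f g g1 g2 : pt -> R) :
  (forall p, open_disk Rd p -> f p = g p) ->
  (forall p, open_disk Rd p -> is_derive (fun a => g (a, snd p)) (fst p) (g1 p) /\
                               is_derive (fun b => g (fst p, b)) (snd p) (g2 p)) ->
  forall p, open_disk Rd p ->
    (ex_derive (fun a => f (a, snd p)) (fst p) /\ ex_derive (fun b => f (fst p, b)) (snd p)) /\
    d1 f p = g1 p /\ d2 f p = g2 p.
Proof.
  intros Hfg Hg p Hp.
  destruct (locally_open_disk_slices Rd p Hp) as [L1 L2]. destruct (Hg p Hp) as [G1 G2].
  assert (F1 : is_derive (fun a => f (a, snd p)) (fst p) (g1 p)).
  { apply (is_derive_ext_loc (fun a => g (a, snd p))); [|exact G1].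
    revert L1. apply filter_imp. intros a Ha. symmetry. exact (Hfg _ Ha). }
  assert (F2 : is_derive (fun b => f (fst p, b)) (snd p) (g2 p)).
  { apply (is_derive_ext_loc (fun b => g (fst p, b))); [|exact G2].
    revert L2. apply filter_imp. intros b Hb. symmetry. exact (Hfg _ Hb). }
  split; [split; eexists; [exact F1|exact F2]|].
  split; apply is_derive_unique; assumption.
Qed.

Lemma continuous_of_eq_on_disk (Rd : R) (f g : pt -> R) (p : pt) :
  (forall z, open_disk Rd z -> f z = g z) -> open_disk Rd p -> continuous g p -> continuous f p.
Proof.
  intros Hfg Hp. apply continuous_ext_loc.
  generalize (locally_open_disk Rd p Hp). apply filter_imp. intros z Hz. symmetry. exact (Hfg z Hz).
Qed.

(** Common shape of all first and second partials of [disk_factor]; the constants select the one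
    wanted. *)
Lemma continuous_rational (Rd a b c d : R) (p : pt) : open_disk Rd p ->
  let g := fun z : pt => / (Rd ^ 2 - nrm2 z) in
  continuous (fun z => g z * (a + b * fst z + c * snd z)
     + g z * g z * d * (fst z * fst z)) p /\
  continuous (fun z => g z * (a + b * fst z + c * snd z)
     + g z * g z * d * (fst z * snd z)) p /\
  continuous (fun z => g z * (a + b * fst z + c * snd z)
     + g z * g z * d * (snd z * snd z)) p.
Proof.
  intros Hp g. unfold open_disk in Hp.
  assert (Hg : continuous g p).
  { apply (continuous_comp nrm2 (fun w => / (Rd ^ 2 - w))); [apply continuous_nrm2|].
    apply (ex_derive_continuous (fun w => / (Rd ^ 2 - w))). auto_derive. simpl in Hp |- *. lra. }
  assert (M : forall h k : pt -> R, continuous h p -> continuous k p -> continuous (fun z => h z * k z) p).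
  { intros h k Hh Hk. exact (continuous_mult (K := R_AbsRing) h k p Hh Hk). }
  assert (P : forall h k : pt -> R, continuous h p -> continuous k p -> continuous (fun z => h z + k z) p).
  { intros h k Hh Hk. exact (continuous_plus (V := R_NormedModule) h k p Hh Hk). }
  assert (Hx : continuous (fun z : pt => fst z) p) by (destruct p; apply continuous_fst).
  assert (Hy : continuous (fun z : pt => snd z) p) by (destruct p; apply continuous_snd).
  assert (Hc : forall w : R, continuous (fun _ : pt => w) p) by (intros w; apply continuous_const).
  assert (Hlin := M _ _ Hg (P _ _ (P _ _ (Hc a) (M _ _ (Hc b) Hx)) (M _ _ (Hc c) Hy))).
  assert (Hq := M _ _ (M _ _ Hg Hg) (Hc d)).
  exact (conj (P _ _ Hlin (M _ _ Hq (M _ _ Hx Hx)))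
        (conj (P _ _ Hlin (M _ _ Hq (M _ _ Hx Hy))) (P _ _ Hlin (M _ _ Hq (M _ _ Hy Hy))))).
Qed.

Lemma disk_factor_partials (Rd : R) (p : pt) : 0 < Rd -> open_disk Rd p ->
  let f := disk_factor Rd in let g := fun z : pt => / (Rd ^ 2 - nrm2 z) in
  (ex_derive (fun a => f (a, snd p)) (fst p) /\ ex_derive (fun b => f (fst p, b)) (snd p)) /\
  d1 f p = 2 * fst p * g p /\ d2 f p = 2 * snd p * g p.
Proof.
  intros HR Hp f g.
  apply (partials_of_eq_on_disk Rd f f (fun p => 2 * fst p * g p) (fun p => 2 * snd p * g p)); [reflexivity| |exact Hp].
  clear p Hp. intros [x y] Hp. unfold open_disk in Hp. unfold f, g, disk_factor, nrm2 in *; cbn [fst snd] in *.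
  assert (Hi : 0 < 2 * Rd / (Rd ^ 2 - (x ^ 2 + y ^ 2))) by (apply Rdiv_lt_0_compat; lra).
  split; auto_derive.
  - split; [simpl in *; lra|split; [exact Hi|exact I]].
  - simpl in *. field. repeat split; lra.
  - split; [simpl in *; lra|split; [exact Hi|exact I]].
  - simpl in *. field. repeat split; lra.
Qed.

Lemma disk_factor_partials2 (Rd : R) (p : pt) : 0 < Rd -> open_disk Rd p ->
  let f := disk_factor Rd in let g := fun z : pt => / (Rd ^ 2 - nrm2 z) in
  ((ex_derive (fun a => d1 f (a, snd p)) (fst p) /\ ex_derive (fun b => d1 f (fst p, b)) (snd p)) /\
   d1 (d1 f) p = 2 * g p + 4 * fst p ^ 2 * g p ^ 2 /\ d2 (d1 f) p = 4 * fst p * snd p * g p ^ 2) /\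
  ((ex_derive (fun a => d2 f (a, snd p)) (fst p) /\ ex_derive (fun b => d2 f (fst p, b)) (snd p)) /\
   d1 (d2 f) p = 4 * fst p * snd p * g p ^ 2 /\ d2 (d2 f) p = 2 * g p + 4 * snd p ^ 2 * g p ^ 2).
Proof.
  intros HR Hp f g. split.
  - apply (partials_of_eq_on_disk Rd (d1 f) (fun p => 2 * fst p * g p)
      (fun p => 2 * g p + 4 * fst p ^ 2 * g p ^ 2) (fun p => 4 * fst p * snd p * g p ^ 2)); [| |exact Hp].
    + intros z Hz. apply (disk_factor_partials Rd z HR Hz).
    + clear p Hp. intros [x y] Hp. unfold open_disk in Hp. unfold g, nrm2 in *; cbn [fst snd] in *.
      split; auto_derive; simpl in *; try lra; field; lra.
  - apply (partials_of_eq_on_disk Rd (d2 f) (fun p => 2 * snd p * g p)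
      (fun p => 4 * fst p * snd p * g p ^ 2) (fun p => 2 * g p + 4 * snd p ^ 2 * g p ^ 2)); [| |exact Hp].
    + intros z Hz. apply (disk_factor_partials Rd z HR Hz).
    + clear p Hp. intros [x y] Hp. unfold open_disk in Hp. unfold g, nrm2 in *; cbn [fst snd] in *.
      split; auto_derive; simpl in *; try lra; field; lra.
Qed.

Lemma disk_factor_C2 (Rd : R) : 0 < Rd -> C2_on (open_disk Rd) (disk_factor Rd).
Proof.
  intros HR p Hp.
  assert (P1 := fun z Hz => disk_factor_partials Rd z HR Hz).
  assert (P2 := fun z Hz => disk_factor_partials2 Rd z HR Hz).
  cbv zeta in P1, P2.
  split.
  - intros h [-> | [-> | ->]]; [apply (P1 p Hp)|apply (P2 p Hp)|apply (P2 p Hp)].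
  - set (g := fun z : pt => / (Rd ^ 2 - nrm2 z)).
    intros h Hh. repeat (destruct Hh as [-> | Hh]); [..|rewrite Hh].
    + apply (continuous_comp nrm2 (fun w => ln (2 * Rd / (Rd ^ 2 - w)))); [apply continuous_nrm2|].
      apply (ex_derive_continuous (fun w => ln (2 * Rd / (Rd ^ 2 - w)))).
      unfold open_disk in Hp. auto_derive.
      assert (Hi : 0 < 2 * Rd / (Rd ^ 2 - nrm2 p)) by (apply Rdiv_lt_0_compat; lra).
      split; [simpl in *; lra|split; [exact Hi|exact I]].
    + apply (continuous_of_eq_on_disk Rd _ (fun z => g z * (0 + 2 * fst z + 0 * snd z)
        + g z * g z * 0 * (fst z * fst z))); [|exact Hp|exact (proj1 (continuous_rational Rd 0 2 0 0 p Hp))].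
      intros z Hz. rewrite (proj1 (proj2 (P1 z Hz))). unfold g. ring.
    + apply (continuous_of_eq_on_disk Rd _ (fun z => g z * (0 + 0 * fst z + 2 * snd z)
        + g z * g z * 0 * (fst z * fst z))); [|exact Hp|exact (proj1 (continuous_rational Rd 0 0 2 0 p Hp))].
      intros z Hz. rewrite (proj2 (proj2 (P1 z Hz))). unfold g. ring.
    + apply (continuous_of_eq_on_disk Rd _ (fun z => g z * (2 + 0 * fst z + 0 * snd z)
        + g z * g z * 4 * (fst z * fst z))); [|exact Hp|exact (proj1 (continuous_rational Rd 2 0 0 4 p Hp))].
      intros z Hz. rewrite (proj1 (proj2 (proj1 (P2 z Hz)))). unfold g. ring.
    + apply (continuous_of_eq_on_disk Rd _ (fun z => g z * (0 + 0 * fst z + 0 * snd z)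
        + g z * g z * 4 * (fst z * snd z))); [|exact Hp|exact (proj1 (proj2 (continuous_rational Rd 0 0 0 4 p Hp)))].
      intros z Hz. rewrite (proj1 (proj2 (proj2 (P2 z Hz)))). unfold g. ring.
    + apply (continuous_of_eq_on_disk Rd _ (fun z => g z * (0 + 0 * fst z + 0 * snd z)
        + g z * g z * 4 * (fst z * snd z))); [|exact Hp|exact (proj1 (proj2 (continuous_rational Rd 0 0 0 4 p Hp)))].
      intros z Hz. rewrite (proj2 (proj2 (proj1 (P2 z Hz)))). unfold g. ring.
    + apply (continuous_of_eq_on_disk Rd _ (fun z => g z * (2 + 0 * fst z + 0 * snd z)
        + g z * g z * 4 * (snd z * snd z))); [|exact Hp|exact (proj2 (proj2 (continuous_rational Rd 2 0 0 4 p Hp)))].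
      intros z Hz. rewrite (proj2 (proj2 (proj2 (P2 z Hz)))). unfold g. ring.
Qed.

Lemma exp_disk_factor (Rd : R) (p : pt) : 0 < Rd -> open_disk Rd p ->
  exp (disk_factor Rd p) = 2 * Rd / (Rd ^ 2 - nrm2 p).
Proof.
  unfold open_disk. intros HR Hp. apply exp_ln. apply Rdiv_lt_0_compat; lra.
Qed.

Lemma gauss_curv_disk_factor (Rd : R) (p : pt) : 0 < Rd -> open_disk Rd p ->
  gauss_curv (disk_factor Rd) p = -1.
Proof.
  intros HR Hp. unfold gauss_curv, lap.
  destruct (disk_factor_partials2 Rd p HR Hp) as [[_ [-> _]] [_ [_ ->]]].
  replace (-2 * disk_factor Rd p) with (- disk_factor Rd p + - disk_factor Rd p) by ring.
  rewrite exp_plus, exp_Ropp, (exp_disk_factor Rd p HR Hp).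
  unfold open_disk, nrm2 in *. field. split; lra.
Qed.

(** * Curve lengths, Riemannian distance and completeness *)

Lemma Glb_Rbar_lt (E : R -> Prop) (e : R) :
  Rbar_lt (Glb_Rbar E) e <-> exists x, E x /\ x < e.
Proof.
  destruct (Glb_Rbar_correct E) as [Hlb Hg]. split.
  - intros Hlt. apply NNPP. intros Hno. apply (Rbar_lt_not_le _ _ Hlt). apply Hg.
    intros x Hx. destruct (Rle_or_lt e x) as [|Hx']; [assumption|]. exfalso; apply Hno; exists x; tauto.
  - intros [x [Hx Hxe]]. apply (Rbar_le_lt_trans _ x); [exact (Hlb x Hx)|exact Hxe].
Qed.

Lemma continuous_speed (g1 g2 : R -> R) (s : R) :
  continuous (Derive g1) s -> continuous (Derive g2) s ->
  continuous (fun s => sqrt (Derive g1 s ^ 2 + Derive g2 s ^ 2)) s.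
Proof.
  intros H1 H2.
  apply (continuous_comp (fun s => Derive g1 s ^ 2 + Derive g2 s ^ 2) sqrt); [|apply continuous_sqrt].
  apply (continuous_plus (V := R_NormedModule) (fun s => Derive g1 s ^ 2) (fun s => Derive g2 s ^ 2)).
  - apply (continuous_comp (Derive g1) (fun w => w ^ 2)); [exact H1|].
    apply (ex_derive_continuous (fun w => w ^ 2)). now auto_derive.
  - apply (continuous_comp (Derive g2) (fun w => w ^ 2)); [exact H2|].
    apply (ex_derive_continuous (fun w => w ^ 2)). now auto_derive.
Qed.

Lemma ex_RInt_length (Rd : R) (g1 g2 : R -> R) (p q : pt) :
  0 < Rd -> adm_curve Rd g1 g2 p q ->
  ex_RInt (fun s => exp (disk_factor Rd (g1 s, g2 s)) *
                 sqrt (Derive g1 s ^ 2 + Derive g2 s ^ 2)) 0 1.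
Proof.
  intros HR [Hadm _].
  apply (ex_RInt_ext (fun s => 2 * Rd / (Rd ^ 2 - (g1 s ^ 2 + g2 s ^ 2)) *
    sqrt (Derive g1 s ^ 2 + Derive g2 s ^ 2))).
  - intros s Hs. rewrite Rmin_left, Rmax_right in Hs by lra.
    rewrite exp_disk_factor; [reflexivity|exact HR|apply Hadm; lra].
  - apply (ex_RInt_continuous (V := R_CompleteNormedModule)). intros s Hs.
    rewrite Rmin_left, Rmax_right in Hs by lra. destruct (Hadm s Hs) as [D1 [D2 [C1 [C2 Ho]]]].
    apply (continuous_mult (K := R_AbsRing) (fun s => 2 * Rd / (Rd ^ 2 - (g1 s ^ 2 + g2 s ^ 2)))).
    + apply (ex_derive_continuous (fun s => 2 * Rd / (Rd ^ 2 - (g1 s ^ 2 + g2 s ^ 2)))).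
      unfold open_disk, nrm2 in Ho; cbn [fst snd] in Ho.
      auto_derive. simpl in Ho |- *. repeat split; try assumption. lra.
    + apply continuous_speed; assumption.
Qed.

(** A calibration argument: the increment of [phi] is the integral of [phi'], which the length
    integrand dominates pointwise. It turns 1-Lipschitz functions into lower bounds for
    distances. *)
Lemma curve_length_ge (Rd : R) (g1 g2 phi phi' : R -> R) (p q : pt) :
  0 < Rd -> adm_curve Rd g1 g2 p q ->
  (forall s, 0 <= s <= 1 -> is_derive phi s (phi' s)) ->
  (forall s, 0 <= s <= 1 -> continuous phi' s) ->
  (forall s, 0 <= s <= 1 -> Rabs (phi' s) <=
     2 * Rd / (Rd ^ 2 - nrm2 (g1 s, g2 s)) * sqrt (Derive g1 s ^ 2 + Derive g2 s ^ 2)) ->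
  Rabs (phi 1 - phi 0) <= curve_length (disk_factor Rd) g1 g2.
Proof.
  intros HR Hadm Hd Hc Hb.
  assert (Hint : is_RInt phi' 0 1 (phi 1 - phi 0)).
  { apply (is_RInt_derive (V := R_CompleteNormedModule) phi phi'); rewrite Rmin_left, Rmax_right by lra; assumption. }
  assert (Hex := ex_RInt_length Rd g1 g2 p q HR Hadm).
  assert (Hb' : forall s, 0 < s < 1 -> Rabs (phi' s) <= exp (disk_factor Rd (g1 s, g2 s)) *
                 sqrt (Derive g1 s ^ 2 + Derive g2 s ^ 2)).
  { intros s Hs. rewrite exp_disk_factor; [apply Hb; lra|exact HR|].
    destruct Hadm as [Hadm _]. apply Hadm. lra. }
  rewrite <- (is_RInt_unique _ _ _ _ Hint). unfold curve_length. apply Rabs_le. split.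
  - rewrite <- (RInt_opp (V := R_CompleteNormedModule)); [|exact Hex].
    apply RInt_le; [lra|apply (ex_RInt_opp (V := R_NormedModule)), Hex|eexists; exact Hint|].
    intros s Hs. specialize (Hb' s Hs). apply Rabs_le_between in Hb'.
    change (- (exp (disk_factor Rd (g1 s, g2 s)) * sqrt (Derive g1 s ^ 2 + Derive g2 s ^ 2)) <= phi' s).
    lra.
  - apply RInt_le; [lra|eexists; exact Hint|exact Hex|].
    intros s Hs. specialize (Hb' s Hs). apply Rabs_le_between in Hb'. lra.
Qed.

Lemma Rabs_le_hypot (a b : R) : Rabs a <= sqrt (a ^ 2 + b ^ 2).
Proof. rewrite <- sqrt_Rsqr_abs. apply sqrt_le_1_alt. unfold Rsqr. nra. Qed.

(* The potential [- ln (Rd^2 - |x|^2)] is 1-Lipschitz for the metric and blows up at the boundary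
   circle, so bounded sets stay away from it. *)
Lemma riem_dist_lower (Rd e : R) (p q : pt) :
  0 < Rd -> Rbar_lt (riem_dist Rd (disk_factor Rd) p q) (Finite e) ->
  Rabs (ln (Rd ^ 2 - nrm2 p) - ln (Rd ^ 2 - nrm2 q)) < e /\
  Rabs (fst q - fst p) < Rd * e /\ Rabs (snd q - snd p) < Rd * e.
Proof.
  intros HR Hlt. apply Glb_Rbar_lt in Hlt.
  destruct Hlt as [L [[g1 [g2 [Hadm ->]]] HL]].
  assert (Hadm' := Hadm). destruct Hadm' as [Hs [Hp Hq]].
  (* The conformal factor is at least [2 / Rd], so each coordinate divided by [Rd] is also
     1-Lipschitz. *)
  assert (Hfac : forall s, 0 <= s <= 1 -> / Rd <= 2 * Rd / (Rd ^ 2 - nrm2 (g1 s, g2 s))).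
  { intros s Hs'. destruct (Hs s Hs') as [_ [_ [_ [_ Ho]]]]. unfold open_disk in Ho.
    pose proof (nrm2_nonneg (g1 s, g2 s)).
    apply Rle_div_r; [lra|]. apply (Rmult_le_reg_l Rd); [exact HR|].
    rewrite <- Rmult_assoc, Rinv_r by lra. nra. }
  assert (Hco : forall g : R -> R, (forall s, 0 <= s <= 1 -> ex_derive g s /\ continuous (Derive g) s /\
       Rabs (Derive g s) <= sqrt (Derive g1 s ^ 2 + Derive g2 s ^ 2)) -> Rabs (g 1 - g 0) < Rd * e).
  { intros g Hg.
    assert (Hle : Rabs (/ Rd * g 1 - / Rd * g 0) <= curve_length (disk_factor Rd) g1 g2).
    { apply (curve_length_ge Rd g1 g2 (fun s => / Rd * g s) (fun s => / Rd * Derive g s) p q HR Hadm).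
      - intros s Hs'. apply (is_derive_scal g s (/ Rd)). apply Derive_correct, Hg, Hs'.
      - intros s Hs'. apply (continuous_scal_r (V := R_NormedModule) (/ Rd) (Derive g)). apply Hg, Hs'.
      - intros s Hs'. rewrite Rabs_mult, (Rabs_pos_eq (/ Rd)) by (apply Rlt_le, Rinv_0_lt_compat, HR).
        apply Rmult_le_compat; [apply Rlt_le, Rinv_0_lt_compat, HR|apply Rabs_pos|apply Hfac, Hs'|apply Hg, Hs']. }
    replace (/ Rd * g 1 - / Rd * g 0) with (/ Rd * (g 1 - g 0)) in Hle by ring.
    rewrite Rabs_mult, (Rabs_pos_eq (/ Rd)) in Hle by (apply Rlt_le, Rinv_0_lt_compat, HR).
    assert (Hlt : / Rd * Rabs (g 1 - g 0) < e) by lra.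
    apply (Rmult_lt_compat_l Rd) in Hlt; [|exact HR].
    rewrite <- Rmult_assoc, Rinv_r, Rmult_1_l in Hlt by lra. exact Hlt. }
  split; [|split].
  - apply Rle_lt_trans with (2 := HL).
    replace (ln (Rd ^ 2 - nrm2 p) - ln (Rd ^ 2 - nrm2 q)) with
      (- ln (Rd ^ 2 - (g1 1 ^ 2 + g2 1 ^ 2)) - - ln (Rd ^ 2 - (g1 0 ^ 2 + g2 0 ^ 2))).
    2:{ rewrite <- Hp, <- Hq. unfold nrm2; cbn [fst snd]. ring. }
    apply (curve_length_ge Rd g1 g2 (fun s => - ln (Rd ^ 2 - (g1 s ^ 2 + g2 s ^ 2)))
      (fun s => 2 / (Rd ^ 2 - (g1 s ^ 2 + g2 s ^ 2)) * (g1 s * Derive g1 s + g2 s * Derive g2 s)) p q HR Hadm).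
    + intros s Hs'. destruct (Hs s Hs') as [D1 [D2 [_ [_ Ho]]]].
      unfold open_disk, nrm2 in Ho; cbn [fst snd] in Ho. auto_derive.
      * simpl in *. repeat split; try assumption; lra.
      * change (Derive (fun x : R => g1 x) s) with (Derive g1 s).
        change (Derive (fun x : R => g2 x) s) with (Derive g2 s).
        simpl in *. field. lra.
    + intros s Hs'. destruct (Hs s Hs') as [D1 [D2 [C1 [C2 Ho]]]].
      unfold open_disk, nrm2 in Ho; cbn [fst snd] in Ho.
      apply (continuous_mult (K := R_AbsRing) (fun s => 2 / (Rd ^ 2 - (g1 s ^ 2 + g2 s ^ 2)))).
      * apply (ex_derive_continuous (fun s => 2 / (Rd ^ 2 - (g1 s ^ 2 + g2 s ^ 2)))).
        auto_derive. simpl in *. repeat split; try assumption; lra.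
      * apply (continuous_plus (V := R_NormedModule) (fun s => g1 s * Derive g1 s) (fun s => g2 s * Derive g2 s)).
        -- apply (continuous_mult (K := R_AbsRing) g1 (Derive g1)); [apply (ex_derive_continuous (V := R_NormedModule) g1 s D1)|exact C1].
        -- apply (continuous_mult (K := R_AbsRing) g2 (Derive g2)); [apply (ex_derive_continuous (V := R_NormedModule) g2 s D2)|exact C2].
    + intros s Hs'. destruct (Hs s Hs') as [_ [_ [_ [_ Ho]]]].
      unfold open_disk, nrm2 in *; cbn [fst snd] in *.
      set (x := g1 s) in *. set (y := g2 s) in *. set (u := Derive g1 s). set (v := Derive g2 s).
      assert (Hi : 0 < 2 / (Rd ^ 2 - (x ^ 2 + y ^ 2))) by (apply Rdiv_lt_0_compat; lra).
      rewrite Rabs_mult, (Rabs_pos_eq _ (Rlt_le _ _ Hi)).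
      replace (2 * Rd / (Rd ^ 2 - (x ^ 2 + y ^ 2)) * sqrt (u ^ 2 + v ^ 2)) with
        (2 / (Rd ^ 2 - (x ^ 2 + y ^ 2)) * (Rd * sqrt (u ^ 2 + v ^ 2))) by (field; lra).
      apply Rmult_le_compat_l; [lra|].
      rewrite <- (Rabs_pos_eq (Rd * sqrt (u ^ 2 + v ^ 2))) by (apply Rmult_le_pos; [lra|apply sqrt_pos]).
      apply Rsqr_le_abs_0. rewrite Rsqr_mult, Rsqr_sqrt by nra.
      unfold Rsqr.
      (* Cauchy-Schwarz from Lagrange's identity; together with [|x| < Rd] it bounds the derivative
         of the potential by the speed. *)
      assert (CS : (x * u + y * v) * (x * u + y * v) <= (x ^ 2 + y ^ 2) * (u ^ 2 + v ^ 2)).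
      { pose proof (pow2_ge_0 (x * v - y * u)). nra. }
      assert (0 <= u ^ 2 + v ^ 2) by nra. nra.
  - replace (fst q - fst p) with (g1 1 - g1 0) by (rewrite <- Hp, <- Hq; reflexivity).
    apply Hco. intros s Hs'. destruct (Hs s Hs') as [D1 [_ [C1 _]]].
    split; [exact D1|split; [exact C1|apply Rabs_le_hypot]].
  - replace (snd q - snd p) with (g2 1 - g2 0) by (rewrite <- Hp, <- Hq; reflexivity).
    apply Hco. intros s Hs'. destruct (Hs s Hs') as [_ [D2 [_ [C2 _]]]].
    split; [exact D2|split; [exact C2|rewrite Rplus_comm; apply Rabs_le_hypot]].
Qed.

(** Test with the straight segment. By convexity it stays where the conformal factor is at most
    [2 Rd / c], and its Euclidean speed is at most [2 d]. *)
Lemma riem_dist_upper (Rd c d e : R) (p q : pt) :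
  0 < Rd -> 0 < c -> nrm2 p <= Rd ^ 2 - c -> nrm2 q <= Rd ^ 2 - c ->
  Rabs (fst q - fst p) <= d -> Rabs (snd q - snd p) <= d -> 4 * Rd / c * d < e ->
  Rbar_lt (riem_dist Rd (disk_factor Rd) p q) (Finite e).
Proof.
  intros HR Hc Hp Hq H1 H2 He. apply Glb_Rbar_lt.
  destruct p as [x y]. destruct q as [x' y']. cbn [fst snd] in *.
  set (g1 := fun s : R => x + s * (x' - x)). set (g2 := fun s : R => y + s * (y' - y)).
  assert (G1 : forall s, is_derive g1 s (x' - x)) by (intros s; unfold g1; auto_derive; [exact I|ring]).
  assert (G2 : forall s, is_derive g2 s (y' - y)) by (intros s; unfold g2; auto_derive; [exact I|ring]).
  assert (E1 : forall s, Derive g1 s = x' - x) by (intros s; apply is_derive_unique, G1).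
  assert (E2 : forall s, Derive g2 s = y' - y) by (intros s; apply is_derive_unique, G2).
  assert (Hn : forall s, 0 <= s <= 1 -> nrm2 (g1 s, g2 s) <= Rd ^ 2 - c).
  { intros s Hs. unfold nrm2 in *; cbn [fst snd] in *. unfold g1, g2.
    replace ((x + s * (x' - x)) ^ 2 + (y + s * (y' - y)) ^ 2) with
      ((1 - s) * (x ^ 2 + y ^ 2) + s * (x' ^ 2 + y' ^ 2) - s * (1 - s) * ((x' - x) ^ 2 + (y' - y) ^ 2)) by ring.
    assert (0 <= s * (1 - s) * ((x' - x) ^ 2 + (y' - y) ^ 2)).
    { apply Rmult_le_pos; [nra|]. pose proof (pow2_ge_0 (x' - x)). pose proof (pow2_ge_0 (y' - y)). lra. }
    nra. }
  assert (Hadm : adm_curve Rd g1 g2 (x, y) (x', y')).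
  { split; [|split; unfold g1, g2; f_equal; ring].
    intros s Hs. split; [eexists; apply G1|]. split; [eexists; apply G2|].
    split; [|split].
    - apply (continuous_ext (fun _ => x' - x)); [intros z; symmetry; apply E1|apply continuous_const].
    - apply (continuous_ext (fun _ => y' - y)); [intros z; symmetry; apply E2|apply continuous_const].
    - unfold open_disk. specialize (Hn s Hs). lra. }
  exists (curve_length (disk_factor Rd) g1 g2). split; [exists g1, g2; split; [exact Hadm|reflexivity]|].
  apply Rle_lt_trans with (2 := He). unfold curve_length.
  replace (4 * Rd / c * d) with (RInt (fun _ => 4 * Rd / c * d) 0 1).
  2:{ rewrite RInt_const. unfold scal; simpl. unfold mult; simpl. ring. }
  apply RInt_le; [lra|apply (ex_RInt_length Rd g1 g2 _ _ HR Hadm)|apply ex_RInt_const|].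
  intros s Hs. rewrite E1, E2. specialize (Hn s ltac:(lra)).
  rewrite exp_disk_factor; [|exact HR|unfold open_disk; lra].
  replace (4 * Rd / c * d) with (2 * Rd / c * (2 * d)) by (field; lra).
  apply Rmult_le_compat.
  - apply Rdiv_le_0_compat; lra.
  - apply sqrt_pos.
  - apply Rmult_le_compat_l; [lra|]. apply Rinv_le_contravar; lra.
  - pose proof (Rabs_pos (x' - x)). rewrite <- (sqrt_pow2 (2 * d)) by lra. apply sqrt_le_1_alt.
    rewrite <- (pow2_abs (x' - x)), <- (pow2_abs (y' - y)).
    pose proof (Rabs_pos (y' - y)). nra.
Qed.

(** A Cauchy sequence converges in coordinates, and the logarithmic potential keeps its tail away
    from the circle. The limit is therefore interior, and on the smaller disk Euclidean convergence
    implies Riemannian convergence. *)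
Lemma complete_disk_factor (Rd : R) : 0 < Rd -> complete_metric Rd (disk_factor Rd).
Proof.
  intros HR x Hx Hcau.
  assert (Hlow := fun e n k => riem_dist_lower Rd e (x n) (x k) HR).
  destruct (Rcomplete.R_complete (fun n => fst (x n))) as [X HX].
  { intros e He. destruct (Hcau (e / Rd)) as [N HN]; [apply Rdiv_lt_0_compat; assumption|].
    exists N. intros n k Hn Hk. specialize (Hlow _ _ _ (HN k n Hk Hn)).
    replace (Rd * (e / Rd)) with e in Hlow by (field; lra). apply Hlow. }
  destruct (Rcomplete.R_complete (fun n => snd (x n))) as [Y HY].
  { intros e He. destruct (Hcau (e / Rd)) as [N HN]; [apply Rdiv_lt_0_compat; assumption|].
    exists N. intros n k Hn Hk. specialize (Hlow _ _ _ (HN k n Hk Hn)).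
    replace (Rd * (e / Rd)) with e in Hlow by (field; lra). apply Hlow. }
  destruct (Hcau 1 Rlt_0_1) as [N HN].
  (* The tail is within distance 1 of [x N], so the logarithm of the gap to the circle falls by less
     than 1. *)
  set (c := exp (ln (Rd ^ 2 - nrm2 (x N)) - 1)).
  assert (Hc : 0 < c) by apply exp_pos.
  assert (Hxc : forall n, (N <= n)%nat -> nrm2 (x n) <= Rd ^ 2 - c).
  { intros n Hn. destruct (Hlow _ _ _ (HN N n (Nat.le_refl N) Hn)) as [Hl _].
    apply Rabs_def2 in Hl. specialize (Hx n). unfold open_disk in Hx.
    assert (c < Rd ^ 2 - nrm2 (x n)).
    { rewrite <- (exp_ln (Rd ^ 2 - nrm2 (x n))) by lra. apply exp_increasing. lra. }
    lra. }
  assert (Hlim : nrm2 (X, Y) <= Rd ^ 2 - c).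
  { apply is_lim_seq_Reals in HX. apply is_lim_seq_Reals in HY.
    assert (Hl : is_lim_seq (fun n => fst (x n) * fst (x n) + snd (x n) * snd (x n)) (X * X + Y * Y)).
    { apply is_lim_seq_plus'; apply is_lim_seq_mult'; assumption. }
    assert (Hle := fun H => is_lim_seq_le_loc _ (fun _ => Rd ^ 2 - c) _ _ H Hl (is_lim_seq_const _)).
    simpl in Hle. unfold nrm2; cbn [fst snd]. replace (X ^ 2 + Y ^ 2) with (X * X + Y * Y) by ring.
    apply Hle. exists N. intros n Hn. specialize (Hxc n Hn). unfold nrm2 in Hxc. simpl in *. lra. }
  exists (X, Y). split; [unfold open_disk; lra|].
  intros eps Heps. set (d := eps * c / (8 * Rd)).
  assert (Hd : 0 < d) by (apply Rdiv_lt_0_compat; nra).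
  destruct (HX d Hd) as [N1 H1]. destruct (HY d Hd) as [N2 H2].
  exists (N + N1 + N2)%nat. intros n Hn.
  apply (riem_dist_upper Rd c d eps (x n) (X, Y) HR Hc); [apply Hxc; lia|exact Hlim| | |].
  - cbn [fst snd]. rewrite Rabs_minus_sym. apply Rlt_le, (H1 n). lia.
  - cbn [fst snd]. rewrite Rabs_minus_sym. apply Rlt_le, (H2 n). lia.
  - unfold d. replace (4 * Rd / c * (eps * c / (8 * Rd))) with (eps / 2) by (field; lra). lra.
Qed.

(** * Convergence *)

(** The double-angle formula for [coth]. The right side is the geodesic curvature of the circle of
    radius [Rd] in the Poincare metric, read off from its conformal factor. *)
Lemma coth_ball_radius (r0 : R) : 0 < r0 ->
  cosh r0 / sinh r0 = (1 + ball_radius r0 ^ 2) / (2 * ball_radius r0).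
Proof.
  intros H. unfold ball_radius, tanh, cosh, sinh.
  replace (exp r0) with (exp (r0 / 2) * exp (r0 / 2)) by (rewrite <- exp_plus; f_equal; field).
  replace (exp (- r0)) with (exp (- (r0 / 2)) * exp (- (r0 / 2))) by (rewrite <- exp_plus; f_equal; field).
  assert (exp (- (r0 / 2)) < exp (r0 / 2)) by (apply exp_increasing; lra).
  pose proof (exp_pos (- (r0 / 2))).
  set (u := exp (r0 / 2)) in *. set (v := exp (- (r0 / 2))) in *.
  field. repeat split; nra.
Qed.

Lemma exp_m2_bounds (t : R) : 0 <= t -> 0 < exp (-2 * t) <= 1.
Proof.
  intros Ht. split; [apply exp_pos|]. rewrite <- exp_0.
  destruct (Rle_lt_or_eq_dec 0 t Ht) as [H | <-]; [apply Rlt_le, exp_increasing; lra|].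
  right. f_equal. ring.
Qed.

Lemma xi_bounds (m t : R) : 0 < m -> 0 <= t -> Rmin 1 m <= xi m t <= 1 + m.
Proof.
  intros Hm Ht. destruct (exp_m2_bounds t Ht). unfold xi, Rmin.
  destruct (Rle_dec 1 m); split; nra.
Qed.

Lemma xi_pos (m t : R) : 0 < m -> 0 <= t -> 0 < xi m t.
Proof.
  intros Hm Ht. destruct (xi_bounds m t Hm Ht) as [H _].
  apply Rlt_le_trans with (2 := H). apply Rmin_pos; lra.
Qed.

(** The flow equation for [xi * g_{-1}]: its curvature is [- / xi], so the equation reduces to this
    linear one. *)
Lemma is_derive_xi (m t : R) : is_derive (xi m) t (2 - 2 * xi m t).
Proof. unfold xi. auto_derive; [exact I|ring]. Qed.

Lemma coth_pos (r0 : R) : 0 < r0 -> 0 < cosh r0 / sinh r0.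
Proof.
  intros H. rewrite (coth_ball_radius r0 H). pose proof (ball_radius_pos r0 H).
  apply Rdiv_lt_0_compat; nra.
Qed.

Lemma kbar_pos (r0 m t : R) : 0 < r0 -> 0 < m -> 0 <= t -> 0 < kbar r0 m t.
Proof.
  intros Hr0 Hm Ht. apply Rmult_lt_0_compat; [|apply coth_pos, Hr0].
  apply Rinv_0_lt_compat, sqrt_lt_R0, xi_pos; assumption.
Qed.

Lemma kbar_le (r0 m t : R) : 0 < r0 -> 0 < m -> 0 <= t ->
  kbar r0 m t <= / sqrt (Rmin 1 m) * (cosh r0 / sinh r0).
Proof.
  intros Hr0 Hm Ht. apply Rmult_le_compat_r; [apply Rlt_le, coth_pos, Hr0|].
  apply Rinv_le_contravar.
  - apply sqrt_lt_R0, Rmin_pos; lra.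
  - apply sqrt_le_1_alt, xi_bounds; assumption.
Qed.

Lemma exp_half_ln (z : R) : 0 < z -> exp (ln z / 2) = sqrt z.
Proof.
  intros Hz. rewrite <- (sqrt_square (exp (ln z / 2))) by (apply Rlt_le, exp_pos).
  f_equal. rewrite <- exp_plus. replace (ln z / 2 + ln z / 2) with (ln z) by field. apply exp_ln, Hz.
Qed.

(* The barrier is the factor of [th * xi t] times the hyperbolic metric of the disk of radius
   [sqrt (q t)], with [q] decreasing from 1 to [Rd^2]. *)
Lemma expanding_barrier (r0 m th c t0 : R) (rho : R -> R) (W : R -> pt -> R) (t : R) (p : pt) :
  let Rd := ball_radius r0 in
  let q := fun s => Rd ^ 2 + (1 - Rd ^ 2) * exp (- c * (s - t0)) in
  0 < r0 -> 0 < m -> 0 < th <= 1 -> 0 <= c -> c * (1 + m) <= / th - 1 -> 0 <= t0 <= t ->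
  (forall s, 0 <= s -> 0 <= rho s) ->
  (forall s s', 0 <= s <= s' -> rho s <= rho s') ->
  (forall s, t0 <= s -> (/ sqrt th - 1) * kbar r0 m s <= rho s) ->
  classical_solution r0 m (fun s => kbar r0 m s + rho s) W ->
  (forall z, closed_disk Rd z -> ln (4 * xi m t0) / 2 - ln (1 - nrm2 z) <= W t0 z) ->
  closed_disk Rd p ->
  ln (4 * th * xi m t * q t) / 2 - ln (q t - nrm2 p) <= W t p.
Proof.
  intros Rd q Hr0 Hm Hth Hc Hcth Ht Hrho0 Hrho Hgap Hsol Hinit Hp.
  pose proof (ball_radius_pos r0 Hr0) as HR. pose proof (ball_radius_lt_1 r0) as HR1.
  fold Rd in HR, HR1.
  assert (HQ : 0 < Rd ^ 2 < 1) by (split; [apply pow_lt|simpl]; nra).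
  assert (Hq : forall s, t0 <= s -> Rd ^ 2 < q s <= 1).
  { intros s Hs. unfold q. pose proof (exp_pos (- c * (s - t0))).
    assert (exp (- c * (s - t0)) <= 1).
    { rewrite <- exp_0. destruct (Rle_lt_or_eq_dec 0 (c * (s - t0))) as [Hlt|Heq]; [nra| |].
      - apply Rlt_le, exp_increasing. lra.
      - right. f_equal. lra. }
    split; nra. }
  assert (HX : forall s, t0 <= s -> 0 < 4 * th * xi m s * q s).
  { intros s Hs. pose proof (xi_pos m s Hm ltac:(lra)). specialize (Hq s Hs).
    repeat apply Rmult_lt_0_compat; lra. }
  assert (Hsqrt : forall s, t0 <= s -> sqrt (4 * th * xi m s * q s)
       = 2 * sqrt th * sqrt (xi m s) * sqrt (q s)).
  { intros s Hs. pose proof (xi_pos m s Hm ltac:(lra)). specialize (Hq s Hs).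
    rewrite !sqrt_mult by nra. replace (sqrt 4) with 2; [ring|].
    replace 4 with (2 * 2) by ring. rewrite sqrt_square; lra. }
  set (a := fun s => ln (4 * th * xi m s * q s) / 2).
  assert (Hea : forall s, t0 <= s -> exp (- a s) = / (2 * sqrt th * sqrt (xi m s) * sqrt (q s))).
  { intros s Hs. rewrite exp_Ropp. f_equal. unfold a. rewrite exp_half_ln by (apply HX, Hs).
    apply Hsqrt, Hs. }
  assert (Hq' : forall s, is_derive q s (- c * (q s - Rd ^ 2))).
  { intros s. unfold q. auto_derive; [exact I|unfold Rminus; ring]. }
  apply (lower_barrier r0 m t0 t (/ sqrt (Rmin 1 m) * (cosh r0 / sinh r0) + rho t)
    (fun s => kbar r0 m s + rho s) a q
    (fun s => (1 - xi m s) / xi m s + - c * (q s - Rd ^ 2) / (2 * q s))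
    (fun s => - c * (q s - Rd ^ 2)) W Hr0 Ht Hsol); [..|lra|exact Hp].
  - intros s Hs. pose proof (xi_pos m s Hm ltac:(lra)) as Hxs. destruct (Hq s ltac:(lra)) as [Hqs _].
    specialize (HX s ltac:(lra)). assert (Dx := is_derive_xi m s). assert (Dq := Hq' s).
    unfold a. auto_derive.
    + repeat split; [eexists; exact Dx|eexists; exact Dq|exact HX].
    + rewrite (is_derive_unique (fun x : R => xi m x) _ _ Dx), (is_derive_unique (fun x : R => q x) _ _ Dq).
      fold Rd. field. repeat split; lra.
  - intros s _. apply Hq'.
  - intros s Hs. apply Hq. lra.
  - intros s Hs. pose proof (kbar_pos r0 m s Hr0 Hm ltac:(lra)). pose proof (kbar_le r0 m s Hr0 Hm ltac:(lra)).
    specialize (Hrho0 s ltac:(lra)). specialize (Hrho s t ltac:(lra)). lra.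
  - intros s Hs. fold Rd. specialize (Hgap s ltac:(lra)). rewrite Hea by lra.
    pose proof (xi_pos m s Hm ltac:(lra)) as Hxs. specialize (Hq s ltac:(lra)).
    apply Rle_trans with (/ sqrt th * kbar r0 m s); [|lra].
    unfold kbar. rewrite (coth_ball_radius r0 Hr0). fold Rd.
    assert (S1 : 0 < sqrt th) by (apply sqrt_lt_R0; lra).
    assert (S2 : 0 < sqrt (xi m s)) by (apply sqrt_lt_R0; lra).
    assert (S3 : 0 < sqrt (q s)) by (apply sqrt_lt_R0; lra).
    assert (S4 : sqrt (q s) * sqrt (q s) = q s) by (apply sqrt_sqrt; lra).
    set (w := sqrt (q s)) in *. rewrite <- S4 in *.
    assert (w <= 1) by nra. assert (Rd ^ 2 <= w) by nra.
    (* Equivalent to [(1 - w) (w - Rd^2) >= 0]. *)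
    assert (Hw : (w * w + Rd ^ 2) / w <= 1 + Rd ^ 2) by (apply Rle_div_l; nra).
    replace (/ (2 * sqrt th * sqrt (xi m s) * w) * (w * w + Rd ^ 2) / Rd) with
      (/ sqrt th * (/ sqrt (xi m s) * / (2 * Rd)) * ((w * w + Rd ^ 2) / w)) by (field; repeat split; lra).
    replace (/ sqrt th * (/ sqrt (xi m s) * ((1 + Rd ^ 2) / (2 * Rd)))) with
      (/ sqrt th * (/ sqrt (xi m s) * / (2 * Rd)) * (1 + Rd ^ 2)) by (field; repeat split; lra).
    apply Rmult_le_compat_l; [|exact Hw].
    repeat apply Rmult_le_pos; apply Rlt_le, Rinv_0_lt_compat; lra.
  - intros s z Hs Hz. unfold open_disk in Hz. fold Rd in Hz |- *.
    pose proof (xi_pos m s Hm ltac:(lra)) as Hxs. destruct (xi_bounds m s Hm ltac:(lra)) as [_ Hxu].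
    specialize (Hq s ltac:(lra)). rewrite Hea by lra.
    assert (S1 : sqrt th * sqrt th = th) by (apply sqrt_sqrt; lra).
    assert (S2 : sqrt (xi m s) * sqrt (xi m s) = xi m s) by (apply sqrt_sqrt; lra).
    assert (S3 : sqrt (q s) * sqrt (q s) = q s) by (apply sqrt_sqrt; lra).
    replace ((/ (2 * sqrt th * sqrt (xi m s) * sqrt (q s))) ^ 2 * (4 * q s)) with (/ th * / xi m s).
    2:{ rewrite pow_inv.
        replace ((2 * sqrt th * sqrt (xi m s) * sqrt (q s)) ^ 2) with
         (4 * (sqrt th * sqrt th) * (sqrt (xi m s) * sqrt (xi m s)) * (sqrt (q s) * sqrt (q s))) by ring.
        rewrite S1, S2, S3. field. repeat split; lra. }
    (* The shrinking of [q] costs at most [c], since [|z| < Rd], and its contribution through [a']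
       has the good sign. The bound [xi <= 1 + m] turns the hypothesis on [c] into
       [c <= (/ th - 1) / xi], the slack available. *)
    assert (Hf : (q s - Rd ^ 2) / (q s - nrm2 z) <= 1) by (apply Rle_div_l; lra).
    assert (Hg : 0 <= c * (q s - Rd ^ 2) / (2 * q s)) by (apply Rdiv_le_0_compat; nra).
    replace ((1 - xi m s) / xi m s + - c * (q s - Rd ^ 2) / (2 * q s) - - c * (q s - Rd ^ 2) / (q s - nrm2 z))
      with (/ xi m s - 1 - c * (q s - Rd ^ 2) / (2 * q s) + c * ((q s - Rd ^ 2) / (q s - nrm2 z)))
      by (field; repeat split; lra).
    assert (Hi : c <= (/ th - 1) * / xi m s).
    { apply (Rmult_le_reg_r (xi m s)); [exact Hxs|]. rewrite Rmult_assoc, Rinv_l by lra. nra. }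
    nra.
  - intros z Hz. fold Rd in Hz. specialize (Hinit z Hz). apply Rle_trans with (2 := Hinit).
    assert (Hq0 : q t0 = 1) by (unfold q; rewrite Rminus_diag, Rmult_0_r, exp_0; ring).
    unfold a. rewrite Hq0. pose proof (xi_pos m t0 Hm ltac:(lra)).
    assert (ln (4 * th * xi m t0 * 1) <= ln (4 * xi m t0)); [|lra].
    apply ln_le; nra.
Qed.

Lemma exp_decay (k s : R) : 0 < k -> 0 < s ->
  exists T, 0 <= T /\ forall t, T <= t -> exp (- k * t) <= s.
Proof.
  intros Hk Hs. exists (Rmax 0 (- ln s / k)). split; [apply Rmax_l|].
  intros t Ht. assert (- ln s / k <= t) by (apply Rle_trans with (2 := Ht); apply Rmax_r).
  apply Rle_div_l in H; [|exact Hk].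
  rewrite <- (exp_ln s Hs).
  destruct (Rle_lt_or_eq_dec (- k * t) (ln s)) as [Hlt | ->]; [lra| |lra].
  apply Rlt_le, exp_increasing, Hlt.
Qed.

(** Here [r] and [n] are squared radii, and [M] is the largest value of the limit metric on the
    smaller disk. Replacing [q] by [Q] costs a factor [(1 - e)^2 >= 1 - 2 e] and [xi] a factor
    [1 - e], in all at most [3 e]. *)
Lemma disk_factor_conv_bounds (Q q r n th x e M : R) :
  0 < Q <= q -> 0 <= n <= r -> r < Q -> M = 4 * Q / (Q - r) ^ 2 ->
  0 < th <= 1 -> 0 <= e <= 1 / 4 -> 1 - e <= x -> q - Q <= e * (Q - r) ->
  4 * Q / (Q - n) ^ 2 <= M /\
  4 * Q / (Q - n) ^ 2 - 4 * th * x * q / (q - n) ^ 2 <= M * (1 - th + 3 * e).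
Proof.
  intros HQ Hn Hr HM Hth He Hx Hq.
  assert (HE : 4 * Q / (Q - n) ^ 2 <= M).
  { rewrite HM. apply Rmult_le_compat_l; [lra|]. apply Rinv_le_contravar; [apply pow_lt; lra|].
    apply pow_incr. lra. }
  split; [exact HE|].
  set (Ei := 4 * Q / (Q - n) ^ 2) in *.
  assert (HEi : 0 < Ei) by (apply Rdiv_lt_0_compat; [lra|apply pow_lt; lra]).
  assert (Hy : 1 - e <= (Q - n) / (q - n)) by (apply Rle_div_r; nra).
  assert (Hlow : Ei * (th * x * (1 - 2 * e)) <= 4 * th * x * q / (q - n) ^ 2).
  { apply Rle_trans with (Ei * (th * x * ((Q - n) / (q - n)) ^ 2)).
    - apply Rmult_le_compat_l; [lra|]. apply Rmult_le_compat_l; [nra|].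
      assert ((1 - e) ^ 2 <= ((Q - n) / (q - n)) ^ 2) by (apply pow_incr; lra). nra.
    - unfold Ei. replace (4 * Q / (Q - n) ^ 2 * (th * x * ((Q - n) / (q - n)) ^ 2)) with
        (4 * th * x * Q / (q - n) ^ 2) by (field; lra).
      apply Rmult_le_compat_r; [apply Rlt_le, Rinv_0_lt_compat, pow_lt; lra|].
      apply Rmult_le_compat_l; [nra|lra]. }
  assert (Hth' : 1 - th * x * (1 - 2 * e) <= 1 - th + 3 * e).
  { assert (th * (1 - e) <= th * x) by nra.
    assert (th * (1 - e) * (1 - 2 * e) <= th * x * (1 - 2 * e)) by nra. nra. }
  apply Rle_trans with (Ei * (1 - th + 3 * e)); [nra|]. apply Rmult_le_compat_r; lra.
Qed.

Theorem theorem1p2 (r0 : R) (k : nat) (m : R) (rho y : R -> R) :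
  0 < r0 -> (2 <= k)%nat -> 0 < m -> m <> 1 ->
  Ck_nonneg k rho ->
  rho 0 = 0 ->
  (forall j, (1 <= j <= k)%nat -> Derive_n rho j 0 = 0) ->
  (forall t, 0 <= t -> 0 <= Derive rho t) ->
  (exists t1, 0 < t1 /\ forall t, 0 < t < t1 -> 0 < Derive rho t) ->
  (1 < m -> forall t, 0 <= t -> (1 - / xi m t) * rho t <= Derive rho t) ->
  Ck_nonneg 3 y ->
  (forall t, 0 <= t -> 0 < y t) ->
  (forall t, 0 <= t -> 3 * y t + 1 <= Derive y t) ->
  (forall t, 0 <= t -> kbar r0 m t + rho t <= Rpower (y t) (1 / 3) - 2) ->
  (m < 1 -> exists T eps, 0 < T /\ 0 < eps /\ forall t, T <= t ->
      eps / ((1 + t) * ln (1 + t)) <= Derive rho t) ->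
  (1 < m -> exists T eps, 0 < T /\ 0 < eps /\ forall t, T <= t ->
      eps / ((1 + t) * ln (1 + t)) <= Derive rho t - (1 - / xi m t) * rho t) ->
  forall W : R -> pt -> R,
    classical_solution r0 m (fun t => kbar r0 m t + rho t) W ->
    exists Winf : pt -> R,
      complete_hyperbolic (ball_radius r0) Winf /\
      loc_unif_conv (ball_radius r0) W Winf.
Proof.
  intros Hr0 Hk Hm _ HCk Hrho0 _ Hrho' [t1 [Ht1 Hrho1]] _ _ _ _ _ _ _ W Hsol.
  pose proof (ball_radius_pos r0 Hr0) as HR. pose proof (ball_radius_lt_1 r0) as HR1.
  exists (disk_factor (ball_radius r0)). split.
  { split; [apply disk_factor_C2, HR|split; [intros p; apply gauss_curv_disk_factor, HR|]].
    apply complete_disk_factor, HR. }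
  assert (Hder : forall s, 0 <= s -> is_derive rho s (Derive rho s)).
  { destruct HCk as [d [Hd HCk]]. intros s Hs. apply Derive_correct.
    exact (proj1 (HCk s ltac:(lra) 1%nat ltac:(lia))). }
  assert (Hmono : forall s s', 0 <= s <= s' -> rho s <= rho s').
  { intros s s' Hs. destruct (Rle_lt_or_eq_dec s s' ltac:(lra)) as [Hlt | <-]; [|lra].
    destruct (MVT_cor2 rho (Derive rho) s s' Hlt) as [u [Hu1 Hu2]].
    - intros u Hu. apply is_derive_Reals, Hder. lra.
    - specialize (Hrho' u ltac:(lra)). nra. }
  assert (Hpos : forall s, 0 <= s -> 0 <= rho s).
  { intros s Hs. rewrite <- Hrho0. apply Hmono. lra. }
  set (T0 := t1 / 2). assert (HT0 : 0 < T0 < t1) by (unfold T0; lra).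
  assert (Hdel : 0 < rho T0).
  { destruct (MVT_cor2 rho (Derive rho) 0 T0 (proj1 HT0)) as [u [Hu1 Hu2]].
    - intros u Hu. apply is_derive_Reals, Hder. lra.
    - specialize (Hrho1 u ltac:(lra)). nra. }
  set (Rd := ball_radius r0) in *.
  assert (HQ : 0 < Rd ^ 2 < 1) by (split; [apply pow_lt|simpl]; nra).
  (* [c = 0] keeps [q] equal to 1, and [th = 1] reduces the curvature gap condition to
     [0 <= rho]. *)
  assert (Hphase1 : forall z, closed_disk Rd z -> ln (4 * xi m T0) / 2 - ln (1 - nrm2 z) <= W T0 z).
  { intros z Hz.
    assert (H1 := expanding_barrier r0 m 1 0 0 rho W T0 z Hr0 Hm ltac:(lra) (Rle_refl 0)
      ltac:(rewrite Rinv_1; lra) ltac:(lra) Hpos Hmono).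
    cbv beta zeta in H1. fold Rd in H1.
    assert (Hq1 : forall w, Rd ^ 2 + (1 - Rd ^ 2) * exp (Ropp 0 * w) = 1).
    { intros w. rewrite Ropp_0, Rmult_0_l, exp_0. ring. }
    rewrite !Hq1 in H1.
    rewrite !Rmult_1_r in H1. apply H1; [|exact Hsol| |exact Hz].
    - intros s Hs. rewrite sqrt_1, Rinv_1. specialize (Hpos s Hs). lra.
    - intros z' Hz'. destruct Hsol as [_ [_ [_ [_ Hinit]]]]. rewrite (Hinit z' Hz').
      unfold closed_disk in Hz'. fold Rd in Hz'.
      unfold hyp_factor, xi. rewrite Rmult_0_r, exp_0.
      replace (1 + 1 * (m - 1)) with m by ring.
      rewrite ln_div, (ln_mult 4 m) by lra. replace 4 with (2 * 2) by ring. rewrite ln_mult by lra. lra. }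
  intros r Hr eps Heps.
  assert (Hr2 : r ^ 2 < Rd ^ 2) by (simpl; nra).
  set (M := 4 * Rd ^ 2 / (Rd ^ 2 - r ^ 2) ^ 2).
  assert (HM : 0 < M) by (apply Rdiv_lt_0_compat; [lra|apply pow_lt; lra]).
  set (K := / sqrt (Rmin 1 m) * (cosh r0 / sinh r0)).
  assert (HK : 0 < K).
  { apply Rlt_le_trans with (kbar r0 m 0); [apply kbar_pos|apply kbar_le]; lra. }
  (* The first bound gives [/ (1 - kap) - 1 <= 2 kap], the second then keeps the extra curvature, at
     most [2 kap K], below [rho T0], and the third makes the loss from [th] at most [eps / 4]. *)
  set (kap := Rmin (1 / 2) (Rmin (rho T0 / (2 * K)) (eps / (8 * M)))).
  assert (Hkap : 0 < kap /\ kap <= 1 / 2 /\ 2 * K * kap <= rho T0 /\ 8 * M * kap <= eps).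
  { assert (0 < rho T0 / (2 * K)) by (apply Rdiv_lt_0_compat; lra).
    assert (0 < eps / (8 * M)) by (apply Rdiv_lt_0_compat; lra).
    unfold kap. split; [repeat apply Rmin_pos; lra|]. split; [apply Rmin_l|]. split.
    - rewrite Rmult_comm. apply Rle_div_r; [lra|].
      apply Rle_trans with (2 := Rmin_l _ (eps / (8 * M))). apply Rmin_r.
    - rewrite Rmult_comm. apply Rle_div_r; [lra|].
      apply Rle_trans with (2 := Rmin_r (rho T0 / (2 * K)) _). apply Rmin_r. }
  destruct Hkap as [Hkap0 [Hkap1 [Hkap2 Hkap3]]]. clearbody kap.
  (* A square, so that [sqrt th = 1 - kap]. *)
  set (th := (1 - kap) ^ 2).
  assert (Hth : 0 < th < 1) by (unfold th; split; nra).
  assert (HthM : M * (1 - th) <= eps / 4).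
  { apply Rle_trans with (M * (2 * kap)); [|lra]. apply Rmult_le_compat_l; [lra|]. unfold th. nra. }
  assert (Hgap : forall s, T0 <= s -> (/ sqrt th - 1) * kbar r0 m s <= rho s).
  { intros s Hs. unfold th. rewrite sqrt_pow2 by lra.
    apply Rle_trans with (2 * kap * K).
    - replace (/ (1 - kap) - 1) with (kap / (1 - kap)) by (field; lra).
      apply Rmult_le_compat.
      + apply Rdiv_le_0_compat; lra.
      + apply Rlt_le, kbar_pos; lra.
      + apply Rle_div_l; nra.
      + apply kbar_le; lra.
    - specialize (Hmono T0 s ltac:(lra)). lra. }
  set (c := (1 - th) / (1 + m)).
  assert (Hc : 0 < c) by (apply Rdiv_lt_0_compat; lra).
  assert (Hcm : c * (1 + m) <= / th - 1).
  { unfold c. replace ((1 - th) / (1 + m) * (1 + m)) with (1 - th) by (field; lra).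
    replace (/ th - 1) with ((1 - th) * / th) by (field; lra).
    assert (1 < / th) by (rewrite <- Rinv_1; apply Rinv_lt_contravar; lra). nra. }
  (* This gives [M e <= eps / 16] and [M m e <= eps / 16]. The error is then at most
     [eps / 4 + 3 eps / 16] from below and [eps / 4 + eps / 16] from above. *)
  set (e := Rmin (1 / 4) (eps / (16 * M * (1 + m)))).
  assert (He : 0 < e /\ e <= 1 / 4 /\ 16 * M * (1 + m) * e <= eps).
  { assert (0 < 16 * M * (1 + m)) by nra.
    assert (0 < eps / (16 * M * (1 + m))) by (apply Rdiv_lt_0_compat; lra).
    unfold e. split; [apply Rmin_pos; lra|]. split; [apply Rmin_l|].
    rewrite Rmult_comm. apply Rle_div_r; [lra|]. apply Rmin_r. }
  destruct He as [He0 [He1 He2]]. clearbody e.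
  destruct (exp_decay 2 e ltac:(lra) He0) as [T1 [HT1 HT1']].
  destruct (exp_decay c (e * (Rd ^ 2 - r ^ 2)) Hc ltac:(nra)) as [T2 [HT2 HT2']].
  exists (T0 + T1 + T2). intros t Ht p Hp. unfold closed_disk in Hp.
  pose proof (nrm2_nonneg p) as Hp0.
  assert (Hpo : open_disk Rd p) by (unfold open_disk; lra).
  assert (Hpc : closed_disk Rd p) by (unfold closed_disk; lra).
  specialize (HT1' t ltac:(lra)). specialize (HT2' (t - T0) ltac:(lra)).
  change (- (2)) with (-2) in HT1'.
  (* The excess [eps / (4 M)] in the multiple contributes at most [eps / 4], as the limit metric is
     at most [M] here. *)
  assert (Hup := upper_barrier r0 m (eps / (4 * M)) _ W t p Hr0 Hm
    ltac:(apply Rdiv_lt_0_compat; lra) Hsol ltac:(lra) Hpo).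
  assert (Hlo := expanding_barrier r0 m th c T0 rho W t p Hr0 Hm ltac:(lra) ltac:(lra) Hcm ltac:(lra)
    Hpos Hmono Hgap Hsol Hphase1 Hpc).
  cbv beta zeta in Hlo. fold Rd in Hup, Hlo.
  set (q := Rd ^ 2 + (1 - Rd ^ 2) * exp (- c * (t - T0))) in *.
  assert (Hq : Rd ^ 2 < q /\ q - Rd ^ 2 <= e * (Rd ^ 2 - r ^ 2)).
  { unfold q. pose proof (exp_pos (- c * (t - T0))). split; nra. }
  assert (Hxi : 1 - e <= xi m t).
  { unfold xi. pose proof (exp_pos (-2 * t)). nra. }
  destruct (disk_factor_conv_bounds (Rd ^ 2) q (r ^ 2) (nrm2 p) th (xi m t) e M)
    as [HE Hdiff]; try lra; [reflexivity|].
  assert (Hinf : exp (2 * disk_factor Rd p) = 4 * Rd ^ 2 / (Rd ^ 2 - nrm2 p) ^ 2).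
  { replace (2 * disk_factor Rd p) with (disk_factor Rd p + disk_factor Rd p) by ring.
    rewrite exp_plus, (exp_disk_factor Rd p HR Hpo). field. lra. }
  assert (Hlo2 : 4 * th * xi m t * q / (q - nrm2 p) ^ 2 <= exp (2 * W t p)).
  { assert (HX : 0 < 4 * th * xi m t * q).
    { pose proof (xi_pos m t Hm ltac:(lra)). repeat apply Rmult_lt_0_compat; lra. }
    replace (4 * th * xi m t * q / (q - nrm2 p) ^ 2) with
      (exp (2 * (ln (4 * th * xi m t * q) / 2 - ln (q - nrm2 p)))).
    - destruct (Rle_lt_or_eq_dec _ _ Hlo) as [Hlt | ->]; [|lra]. apply Rlt_le, exp_increasing. lra.
    - replace (2 * (ln (4 * th * xi m t * q) / 2 - ln (q - nrm2 p))) with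
        (ln (4 * th * xi m t * q) + - (ln (q - nrm2 p) + ln (q - nrm2 p))) by field.
      rewrite exp_plus, exp_Ropp, exp_plus, !exp_ln by lra. field. lra. }
  assert (Hup2 : exp (2 * W t p) <= 4 * Rd ^ 2 / (Rd ^ 2 - nrm2 p) ^ 2 * (1 + eps / (4 * M) + m * exp (-2 * t))).
  { replace (4 * Rd ^ 2 / (Rd ^ 2 - nrm2 p) ^ 2 * (1 + eps / (4 * M) + m * exp (-2 * t))) with
      (4 * Rd ^ 2 * (1 + eps / (4 * M) + m * exp (-2 * t)) / (Rd ^ 2 - nrm2 p) ^ 2) by (field; lra).
    apply Rle_div_r; [apply pow_lt; lra|exact Hup]. }
  rewrite Hinf. set (Ei := 4 * Rd ^ 2 / (Rd ^ 2 - nrm2 p) ^ 2) in *.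
  assert (HMe : M * e <= eps / 16).
  { assert (0 < M * e) by nra. nra. }
  assert (HMme : M * (m * e) <= eps / 16).
  { assert (0 < M * e) by nra. nra. }
  apply Rabs_def1.
  - assert (Hs : 0 <= eps / (4 * M) + m * exp (-2 * t)).
    { pose proof (exp_pos (-2 * t)). assert (0 < eps / (4 * M)) by (apply Rdiv_lt_0_compat; lra). nra. }
    assert (H1 := Rmult_le_compat_r _ _ _ Hs HE).
    assert (H2 : M * (eps / (4 * M)) = eps / 4) by (field; lra).
    assert (H3 : M * (m * exp (-2 * t)) <= M * (m * e)).
    { apply Rmult_le_compat_l; [lra|]. apply Rmult_le_compat_l; lra. }
    lra.
  - lra.
Qed.
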